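(* Let $\mathcal{X}_n=(X_n,\rho_n,\mu_n)$, $n\in\mathbb{N}\cup\{\infty\}$, be elements of $\mathfrak{M}_\bullet(\tau_{\mathcal M})$, i.e. (equivalence classes of) rooted bcm spaces equipped with Radon measures. The following are equivalent: (i) $\mathcal{X}_n\to\mathcal{X}_\infty$ in the local GH-type topology on $\mathfrak{M}_\bullet(\tau_{\mathcal M})$; (ii) there exist a rooted bcm space $(M,\rho_M)$ and root-preserving isometric embeddings $f_n\colon X_n\to M$, $n\in\mathbb{N}\cup\{\infty\}$, such that $f_n(X_n)\to f_\infty(X_\infty)$ in the Fell topology as subsets of $M$ and $\mu_n\circ f_n^{-1}\to\mu_\infty\circ f_\infty^{-1}$ vaguely as measures on $M$; (iii) there exist a bcm space $M$ and isometric embeddings $f_n\colon X_n\to M$, $n\in\mathbb{N}\cup\{\infty\}$, such that $f_n(X_n)\to f_\infty(X_\infty)$ in the Fell topology as subsets of $M$, $f_n(\rho_n)\to f_\infty(\rho_\infty)$ in $M$, and $\mu_n\circ f_n^{-1}\to\mu_\infty\circ f_\infty^{-1}$ vaguely as measures on $M$; (iv) $\mathcal{X}_n\to\mathcal{X}_\infty$ in the local Gromov--Hausdorff-vague topology.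
   Context: A bcm (boundedly-compact metric) space is a non-empty metric space in which every closed ball of finite radius is compact; a rooted bcm space $(X,\rho_X)$ is a bcm space $X$ with a distinguished point $\rho_X$. $d_X$ is the metric of $X$, $D_X(x,r)=\{y: d_X(x,y)\le r\}$. An isometric embedding is a distance-preserving map (not necessarily onto); an isometry is a bijective one; root-preserving means sending root to root. A Radon measure on $X$ is a Borel measure finite on compact sets; vague convergence means convergence of integrals of all compactly supported continuous functions. The Fell topology on closed subsets of $M$ is generated by the sets $\{A: A\cap K=\emptyset\}$ ($K$ compact) and $\{A: A\cap U\ne\emptyset\}$ ($U$ open). $\mathfrak{M}_\bullet(\tau_{\mathcal M})$: the set of (representatives of) equivalence classes of triples $(X,\rho_X,\mu_X)$ with $(X,\rho_X)$ a rooted bcm space and $\mu_X$ a Radon measure on $X$, where two triples are equivalent iff there is a root-preserving isometry pushing one measure to the other. Metrics. Hausdorff metric: $d^H_M(A,B)=\inf\{\varepsilon\ge0: A\subseteq B^\varepsilon,B\subseteq A^\varepsilon\}$ for compact $A,B\subseteq M$, with $A^\varepsilon=\{x:\exists y\in A,d_M(x,y)\le\varepsilon\}$, $\inf\emptyset=\infty$. Prohorov metric: $d^P_M(\mu,\nu)=\inf\{\varepsilon>0:\mu(A)\le\nu(A^\varepsilon)+\varepsilon,\ \nu(A)\le\mu(A^\varepsilon)+\varepsilon\text{ for all Borel }A\}$ for finite Borel measures. For a rooted bcm space $(M,\rho)$, closed sets $A,B$ and Radon measures $\mu,\nu$ on $M$, $$d^F_{M,\rho}(A,B)=\int_0^\infty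 e^{-r}(1\wedge d^H_M(A\cap D_M(\rho,r),B\cap D_M(\rho,r)))dr,$$ $$d^V_{M,\rho}(\mu,\nu)=\int_0^\infty e^{-r}(1\wedge d^P_M(\mu|_{D_M(\rho,r)},\nu|_{D_M(\rho,r)}))dr,$$ where $\mu|_{D}(\cdot)=\mu(\cdot\cap D)$. The local GH-type topology on $\mathfrak{M}_\bullet(\tau_{\mathcal M})$ is the topology induced by the metric $$d(\mathcal{X},\mathcal{Y})=\inf_{f,g,Z}\{d^F_{Z,\rho_Z}(f(X),g(Y))\vee d^V_{Z,\rho_Z}(\mu_X\circ f^{-1},\mu_Y\circ g^{-1})\},$$ the infimum over rooted bcm spaces $(Z,\rho_Z)$ and root-preserving isometric embeddings $f\colon X\to Z$, $g\colon Y\to Z$. (The analogous metric in which roots are not required to be mapped to a common point induces the same topology.) The local Gromov--Hausdorff-vague topology is induced by the metric $d_{\mathrm{GHV}}(\mathcal{X}_1,\mathcal{X}_2)=\int_0^\infty e^{-r}(1\wedge d_{\mathrm{pGHP}}(\mathcal{X}_1^{(r)},\mathcal{X}_2^{(r)}))dr$, where for $\mathcal{X}=(X,\rho,\mu)$, $\mathcal{X}^{(r)}=(D_X(\rho,r),\rho,\mu|_{D_X(\rho,r)})$, and for rooted compact metric spaces with finite Borel measures $\mathcal{K}_i=(K_i,\rho_i,\mu_i)$, $$d_{\mathrm{pGHP}}(\mathcal{K}_1,\mathcal{K}_2)=\inf_{f_1,f_2,K}\{d^H_K(f_1(K_1),f_2(K_2))\vee d^P_K(\mu_1\circ f_1^{-1},\mu_2\circ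 f_2^{-1})\vee d_K(f_1(\rho_1),f_2(\rho_2))\},$$ over compact metric spaces $K$ and isometric embeddings $f_i\colon K_i\to K$. *)

(* Defs.v *)
From HB Require Import structures.
From mathcomp Require Import all_boot all_order all_algebra.
From mathcomp Require Import all_classical all_reals all_analysis.

Set Implicit Arguments.
Unset Strict Implicit.
Unset Printing Implicit Defensive.

Import Order.TTheory GRing.Theory Num.Theory.
Import numFieldNormedType.Exports.

Local Open Scope classical_set_scope.
Local Open Scope ring_scope.

(* A non-empty metric space.  The chosen [point] serves as the root of a rooted
   space; for an unrooted space it only witnesses non-emptiness. *)
#[short(type="pmetricType")]
HB.structure Definition PointedMetric (R : numDomainType) :=
  {T of Metric R T & Pointed T}.

(* The library's [closed_ball] is the closure of the open ball, which can be
   smaller than this one. *)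
Definition cdisk (R : realType) (X : metricType R) (x : X) (r : R) : set X :=
  [set y | mdist x y <= r].

HB.mixin Record isBoundedlyCompact (R : realType) X & Metric R X := {
  cdisk_compact : forall (x : X) (r : R), compact (cdisk x r)
}.

#[short(type="bcmType")]
HB.structure Definition BoundedlyCompact (R : realType) :=
  {X of PointedMetric R X & isBoundedlyCompact R X}.

Definition rootpt {R : realType} (X : pmetricType R) : X := point.

Notation borel X := (g_sigma_algebraType (@open X)).

Section metric_facts.
Context {R : realType}.

Lemma cdiskxx (X : metricType R) (x : X) (r : {nonneg R}) : cdisk x r%:num x.
Proof. by rewrite /cdisk/= mdistxx. Qed.

Lemma continuous_mdist (X : metricType R) (x : X) : continuous (mdist x : X -> R).
Proof.
move=> y; apply/(@cvgrPdist_lt _ R^o) => e e0.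
near=> z.
have yz : mdist y z < e.
  by near: z; apply: metricType_numDomainType.cvgr_dist_lt.
rewrite ltr_norml; apply/andP; split.
  rewrite ltrNl opprB ltrBlDr (le_lt_trans (metric_triangle x y z))//.
  by rewrite addrC ltrD2r.
rewrite ltrBlDr (le_lt_trans (metric_triangle x z y))//.
by rewrite addrC ltrD2r metric_sym.
Unshelve. all: by end_near. Qed.

Lemma cdisk_closed (X : metricType R) (x : X) (r : R) : closed (cdisk x r).
Proof.
rewrite (_ : cdisk x r = mdist x @^-1` [set s | s <= r])//.
apply: preimage_closed => [y _|]; first exact: continuous_mdist.
exact: closed_le.
Qed.

Lemma closed_borel (X : pmetricType R) (A : set X) :
  closed A -> measurable (A : set (borel X)).
Proof.
move=> cA; rewrite -[A]setCK; apply: measurableC.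
by apply: sub_sigma_algebra; exact: closed_openC.
Qed.

Lemma cdisk_borel (X : pmetricType R) (x : X) (r : R) :
  measurable (cdisk x r : set (borel X)).
Proof. by apply: closed_borel; exact: cdisk_closed. Qed.

End metric_facts.

Section isometric_embeddings.
Context {R : realType}.

Record isoEmb (X Y : metricType R) := IsoEmb {
  isoEmb_fun :> X -> Y;
  isoEmbP : forall x y, mdist (isoEmb_fun x) (isoEmb_fun y) = mdist x y
}.

Definition root_preserving (X Y : pmetricType R) (f : isoEmb X Y) : Prop :=
  f (rootpt X) = rootpt Y.

Lemma isoEmb_continuous (X Y : metricType R) (f : isoEmb X Y) : continuous f.
Proof.
move=> x; apply/metricType_numDomainType.cvgrPdist_lt => e e0.
near=> z; rewrite isoEmbP; near: z.
exact: metricType_numDomainType.cvgr_dist_lt.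
Unshelve. all: by end_near. Qed.

Lemma isoEmb_measurable (X Y : pmetricType R) (f : isoEmb X Y) :
  measurable_fun [set: borel X] (f : borel X -> borel Y).
Proof.
apply: (measurability (@open Y : set (set (borel Y)))) => //.
move=> _ [B oB <-]; rewrite setTI; apply: sub_sigma_algebra => /=.
by have /continuousP := @isoEmb_continuous _ _ f; exact.
Qed.

Lemma isoEmb_range_closed (X : bcmType R) (Y : metricType R) (f : isoEmb X Y) :
  closed (range f).
Proof.
move=> y cly; set r := mdist (f point) y + 1.
have fcpt : closed (f @` cdisk point r).
  apply: compact_closed; first exact: metric_hausdorff.
  apply: continuous_compact; last exact: cdisk_compact.
  by apply: continuous_subspaceT; exact: isoEmb_continuous.
suff /fcpt [x _ <-] : closure (f @` cdisk point r) y by exists x.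
move=> B nB.
have : nbhs y (B `&` ball y 1) by apply: filterI => //; exact: nbhsx_ballx.
move=> /cly [_ [[x _ <-] [Bx]]]; rewrite ballEmdist/= => yx.
exists (f x); split => //; exists x => //.
rewrite /cdisk/= -(isoEmbP f) (le_trans (metric_triangle _ y _))//.
by rewrite lerD2l ltW.
Qed.

End isometric_embeddings.

Section image_measure.
Context {R : realType} {X Y : pmetricType R} (f : isoEmb X Y).
Variable mu : {measure set (borel X) -> \bar R}.

Definition image_measure : set (borel Y) -> \bar R :=
  pushforward mu (f : borel X -> borel Y).

Let image_measure0 : image_measure set0 = 0%E.
Proof. by rewrite /image_measure /pushforward preimage_set0 measure0. Qed.

Let image_measure_ge0 A : (0 <= image_measure A)%E.
Proof. exact: (measure_ge0 mu). Qed.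

Let image_measure_sigma_additive : semi_sigma_additive image_measure.
Proof.
have mf (B : set (borel Y)) :
    measurable B -> measurable ((f : borel X -> borel Y) @^-1` B).
  by move=> mB; rewrite -[X in measurable X]setTI; exact: isoEmb_measurable.
move=> F mF tF mUF; rewrite /image_measure /pushforward preimage_bigcup.
apply: measure_semi_sigma_additive => //.
- by move=> n; exact: mf.
- apply/trivIsetP => i j _ _ ij; rewrite -preimage_setI.
  by move/trivIsetP : tF => /(_ i j I I ij) ->; rewrite preimage_set0.
- by rewrite -preimage_bigcup; exact: mf.
Qed.

HB.instance Definition _ := isMeasure.Build _ _ _ image_measure
  image_measure0 image_measure_ge0 image_measure_sigma_additive.

End image_measure.

Definition radon (R : realType) (X : pmetricType R)
    (mu : {measure set (borel X) -> \bar R}) : Prop :=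
  forall K : set X, compact K -> (mu K < +oo)%E.

(* Rooted bcm spaces with a Radon measure (representatives of the equivalence
   classes). *)
Record rbcmm (R : realType) := Rbcmm {
  space :> bcmType R;
  meas : {measure set (borel space) -> \bar R};
  meas_radon : radon meas
}.

(* Rooted compact metric spaces with a finite Borel measure. *)
Record rcmm (R : realType) := Rcmm {
  cspace :> pmetricType R;
  cspace_compact : compact [set: cspace];
  cmeas : {measure set (borel cspace) -> \bar R};
  cmeas_finite : (cmeas [set: cspace] < +oo)%E
}.

Definition closedSet (X : topologicalType) := {A : set X | closed A}.

Definition isoEmb_range (R : realType) (X : bcmType R) (Y : metricType R)
    (f : isoEmb X Y) : closedSet Y :=
  exist _ (range f) (@isoEmb_range_closed _ _ _ f).

Definition miss (X : topologicalType) (K : set X) : set (closedSet X) :=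
  [set A | sval A `&` K = set0].

Definition hit (X : topologicalType) (U : set X) : set (closedSet X) :=
  [set A | sval A `&` U !=set0].

HB.instance Definition _ (X : topologicalType) := gen_eqMixin (closedSet X).
HB.instance Definition _ (X : topologicalType) := gen_choiceMixin (closedSet X).

(* The Fell topology. *)
HB.instance Definition _ (X : topologicalType) :=
  isSubBaseTopological.Build (closedSet X)
    ([set miss K | K in compact] `|` [set hit U | U in open]) id.

Definition vague_cvg (R : realType) (X : pmetricType R)
    (mu_ : {measure set (borel X) -> \bar R}^nat)
    (mu : {measure set (borel X) -> \bar R}) : Prop :=
  forall h : X -> R, continuous h -> compact (closure [set x | h x != 0]) ->
    (\int[mu_ n]_x (h x)%:E)%E @[n --> \oo] --> (\int[mu]_x (h x)%:E)%E.

Section metrics.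
Context {R : realType}.
Local Open Scope ereal_scope.

Definition enlarge (X : metricType R) (A : set X) (e : R) : set X :=
  [set x | exists2 y, A y & (mdist x y <= e)%R].

Definition dH (X : metricType R) (A B : set X) : \bar R :=
  ereal_inf [set e%:E | e in [set e : R |
    [/\ (0 <= e)%R, A `<=` enlarge B e & B `<=` enlarge A e]]].

(* For Borel [A] the set [enlarge A e] is analytic, hence universally
   measurable, but need not be Borel; the outer measure [nu^*] gives the value
   of the completion of [nu] on it, and is [nu] itself on Borel sets. *)
Definition dP (X : pmetricType R) (mu nu : {measure set (borel X) -> \bar R}) :
    \bar R :=
  ereal_inf [set e%:E | e in [set e : R | (0 < e)%R /\
    forall A : set (borel X), measurable A ->
      mu A <= (nu^*)%mu (enlarge (A : set X) e) + e%:E /\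
      nu A <= (mu^*)%mu (enlarge (A : set X) e) + e%:E]].

Definition local_integral (D : R -> \bar R) : \bar R :=
  \int[lebesgue_measure]_(r in `[0%R, +oo[) ((expR (- r))%:E * mine 1 (D r)).

Definition dF (Z : bcmType R) (A B : closedSet Z) : \bar R :=
  local_integral (fun r =>
    dH (sval A `&` cdisk (rootpt Z) r) (sval B `&` cdisk (rootpt Z) r)).

Definition dV (Z : bcmType R) (mu nu : {measure set (borel Z) -> \bar R}) :
    \bar R :=
  local_integral (fun r =>
    dP (mrestr mu (cdisk_borel (rootpt Z) r)) (mrestr nu (cdisk_borel (rootpt Z) r))).

Definition d_local (X Y : rbcmm R) : \bar R :=
  ereal_inf [set d | exists (Z : bcmType R) (f : isoEmb X Z) (g : isoEmb Y Z),
    [/\ root_preserving f, root_preserving g &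
        d = maxe (dF (isoEmb_range f) (isoEmb_range g))
                 (dV (image_measure f (meas X)) (image_measure g (meas Y)))]].

Definition d_pGHP (K1 K2 : rcmm R) : \bar R :=
  ereal_inf [set d | exists (K : pmetricType R)
      (f1 : isoEmb K1 K) (f2 : isoEmb K2 K),
    compact [set: K] /\
    d = maxe (maxe (dH (range f1) (range f2))
                   (dP (image_measure f1 (cmeas K1))
                       (image_measure f2 (cmeas K2))))
             (mdist (f1 (rootpt K1)) (f2 (rootpt K2)))%:E].

End metrics.

Section set_type_metric.
Context {R : realType} {X : metricType R} (A : set X).

Let sdist (x y : set_type A) : R := mdist (set_val x) (set_val y).

Let sdist_ge0 x y : 0 <= sdist x y. Proof. exact: mdist_ge0. Qed.

Let sdist_positivity x y : sdist x y = 0 -> x = y.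
Proof. by move=> /mdist_positivity; exact: val_inj. Qed.

Let ballEsdist x d : ball x d = [set y | sdist x y < d].
Proof.
by rewrite (_ : ball x d = set_val @^-1` ball (set_val x) d)// ballEmdist.
Qed.

HB.instance Definition _ := PseudoMetric_isMetric.Build R (set_type A)
  sdist_ge0 sdist_positivity ballEsdist.

End set_type_metric.

Lemma set_type_compact (X : topologicalType) (A : set X) :
  compact A -> compact [set: set_type A].
Proof.
move=> cA F FF _.
have FA : (set_val @ F) A by apply: (@filterE _ F) => x; exact: set_valP.
have [p [Ap clp]] := cA (set_val @ F) _ FA.
exists (exist _ p (mem_set Ap)); split => // B C FB.
rewrite nbhsE => -[_ [[V oV <-] Vp] VC].
have [_ [[x Bx <-] Vx]] : set_val @` B `&` V !=set0.
  apply: clp; last by apply: open_nbhs_nbhs; split.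
  by apply: (@filterS _ F _ B) => // x Bx; exists x.
by exists x; split => //; exact: VC.
Qed.

Section truncation.
Context {R : realType}.

Section ball_space.
Context (X : pmetricType R) (r : {nonneg R}).

Definition ball_space : Type := set_type (cdisk (rootpt X) r%:num).

HB.instance Definition _ := Metric.on ball_space.
HB.instance Definition _ := isPointed.Build ball_space
  (exist _ (rootpt X) (mem_set (cdiskxx (rootpt X) r))).

Lemma ball_space_image_borel (B : set (borel ball_space)) :
  measurable B -> measurable (set_val @` B : set (borel X)).
Proof.
pose D := cdisk (rootpt X) r%:num.
have mD : measurable (D : set (borel X)) by exact: cdisk_borel.
pose S : set (set ball_space) :=
  [set C | measurable (set_val @` C : set (borel X))].
suff : <<s open >> `<=` S by apply.
apply: smallest_sub.
  split => [|C SC|F SF]; rewrite /S/=.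
  - by rewrite image_set0.
  - rewrite (_ : _ @` _ = D `\` set_val @` C); first exact: measurableD.
    apply/seteqP; split => [_ [x [_ nCx] <-]|x [Dx nCx]].
      split; first exact: set_valP.
      by move=> [y Cy /val_inj yx]; apply: nCx; rewrite -yx.
    exists (exist _ x (mem_set Dx)) => //; split => // Cx; apply: nCx.
    by exists (exist _ x (mem_set Dx)).
  - by rewrite image_bigcup; exact: bigcupT_measurable.
move=> _ [V oV <-]; rewrite /S/=.
rewrite (_ : _ @` _ = D `&` V).
  by apply: measurableI => //; exact: sub_sigma_algebra.
apply/seteqP; split => [_ [x Vx <-]|x [Dx Vx]].
  by split => //; exact: set_valP.
by exists (exist _ x (mem_set Dx)).
Qed.

Variable mu : {measure set (borel X) -> \bar R}.

(* The restriction of [mu] to the ball, as a measure on the ball itself. *)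
Definition ball_measure (B : set (borel ball_space)) : \bar R :=
  mu (set_val @` B).

Let ball_measure0 : ball_measure set0 = 0%E.
Proof. by rewrite /ball_measure image_set0 measure0. Qed.

Let ball_measure_ge0 B : (0 <= ball_measure B)%E.
Proof. exact: (measure_ge0 mu). Qed.

Let ball_measure_sigma_additive : semi_sigma_additive ball_measure.
Proof.
move=> F mF tF mUF; rewrite /ball_measure image_bigcup.
apply: measure_semi_sigma_additive.
- by move=> n; exact: ball_space_image_borel.
- apply/trivIsetP => i j _ _ ij; rewrite -subset0 => _ [[x Fx <-] [y Fy]].
  move=> /val_inj yx; move/trivIsetP : tF => /(_ i j I I ij).
  by rewrite -subset0; apply; split; [exact: Fx|rewrite -yx].
- by rewrite -image_bigcup; exact: ball_space_image_borel.
Qed.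

HB.instance Definition _ := isMeasure.Build _ _ _ ball_measure
  ball_measure0 ball_measure_ge0 ball_measure_sigma_additive.

End ball_space.

Lemma ball_space_compact (X : bcmType R) (r : {nonneg R}) :
  compact [set: ball_space X r].
Proof. by apply: set_type_compact; exact: cdisk_compact. Qed.

Lemma ball_measure_finite (X : rbcmm R) (r : {nonneg R}) :
  (ball_measure (meas X) [set: ball_space X r] < +oo)%E.
Proof.
rewrite /ball_measure (_ : _ @` _ = cdisk (rootpt X) r%:num).
  by apply: meas_radon; exact: cdisk_compact.
apply/seteqP; split => [_ [x _ <-]|x Dx]; first exact: set_valP.
by exists (exist _ x (mem_set Dx)).
Qed.

Definition trunc (X : rbcmm R) (r : {nonneg R}) : rcmm R :=
  Rcmm (@ball_space_compact X r) (@ball_measure_finite X r).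

(* [`|r|] only casts the integration variable [r >= 0] to [{nonneg R}]. *)
Definition d_GHV (X Y : rbcmm R) : \bar R :=
  local_integral (fun r => d_pGHP (trunc X `|r|%:nng) (trunc Y `|r|%:nng)).

End truncation.

(* [d] is a metric only up to equivalence of representatives; limits in the
   induced topology are the sequences at distance tending to 0. *)
Definition cvg_metric (R : realType) (T : Type) (d : T -> T -> \bar R)
    (x_ : nat -> T) (x : T) : Prop :=
  d (x_ n) x @[n --> \oo] --> 0%E.

(* Main.v *)
(** All four convergences are compared with the following condition: for
    every radius [r] and [e > 0], eventually there is a "cross-distance"
    extending the metrics of [X_n] and [X] to their disjoint union, with the two
    roots at distance 0, such that the balls of radius [r] and the measures on
    them are [e]-close.

    If a local integral is small, its integrand is small at some radius
    [s >= r]; this gives the cross-distances from (i) and (iv).  In case (iv) the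
    roots are only close, and all other distances are raised by the distance of
    the roots before the roots are identified.  Cross-distances with [X] glue
    all the [X_n] along [X]: points of different [X_n] and [X_m] are at distance
    [inf_x (del_n u x + del_m v x)].  The glued space is boundedly compact since
    each of its balls lies, up to any [e], in a finite union of compact balls.
    Fell convergence is then immediate, and vague convergence follows by
    approximating a test function by a sum of indicators of its superlevel sets.

    Conversely, in a common space, Fell and vague convergence imply Hausdorff and
    Prohorov convergence of the restrictions to [cdisk p_n r], for all [r] outside
    a countable set (jumps of the truncation of the limit set, spheres charged by
    the limit measure), and the local integrals converge by dominated
    convergence. *)

Require Import Defs.
From HB Require Import structures.
From mathcomp Require Import all_boot all_order all_algebra finmap.
From mathcomp Require Import all_classical all_reals all_analysis.
From mathcomp Require Import lra measurable_realfun.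

Set Implicit Arguments.
Unset Strict Implicit.
Unset Printing Implicit Defensive.

Import Order.TTheory GRing.Theory Num.Theory.
Import numFieldNormedType.Exports.

Local Open Scope classical_set_scope.
Local Open Scope ring_scope.

(** * Metric preliminaries *)

Section metric_basics.
Context {R : realType}.
Implicit Type X : metricType R.

(** The infimum over an empty [A] is the default 0, which is why non-emptiness is assumed in most
    facts about it. *)
Definition dset X (A : set X) (x : X) : R := inf [set mdist x y | y in A].

Lemma dset_has_inf X (A : set X) x : A !=set0 ->
  has_inf [set mdist x y | y in A].
Proof.
move=> [a Aa]; split; first by exists (mdist x a), a.
by exists 0 => _ [y _ <-]; exact: mdist_ge0.
Qed.

Lemma dset_le X (A : set X) x y : A y -> dset A x <= mdist x y.
Proof.
move=> Ay; apply: ge_inf; last by exists y.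
by exists 0 => _ [z _ <-]; exact: mdist_ge0.
Qed.

Lemma dset_ge0 X (A : set X) x : A !=set0 -> 0 <= dset A x.
Proof.
move=> [a Aa]; apply: lb_le_inf; first by exists (mdist x a), a.
by move=> _ [y _ <-]; exact: mdist_ge0.
Qed.

Lemma dset_lt X (A : set X) x e : A !=set0 -> dset A x < e ->
  exists2 y, A y & mdist x y < e.
Proof.
move=> A0; rewrite -subr_gt0 => e0.
have [_ [y Ay <-]] := inf_adherent e0 (dset_has_inf x A0).
by rewrite addrC subrK => xy; exists y.
Qed.

Lemma dset_lip X (A : set X) x y : A !=set0 -> dset A x <= mdist x y + dset A y.
Proof.
move=> A0; apply/ler_addgt0Pr => e e0.
have [z Az yz] : exists2 z, A z & mdist y z < dset A y + e.
  by apply: dset_lt => //; rewrite ltrDl.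
have := metric_triangle x y z; have := dset_le x Az; lra.
Qed.

Lemma lip_continuous X (h : X -> R) (k : R) : 0 < k ->
  (forall x y, h x <= k * mdist x y + h y) -> continuous h.
Proof.
move=> k0 hk x; apply/(@cvgrPdist_lt _ R^o) => e e0.
near=> y.
have xy : mdist x y < e / k.
  by near: y; apply: metricType_numDomainType.cvgr_dist_lt => //; rewrite divr_gt0.
rewrite ltr_pdivlMr// in xy.
have := hk x y; have := hk y x; rewrite [mdist y x]metric_sym => h1 h2.
by rewrite ltr_norml; apply/andP; split; lra.
Unshelve. all: by end_near. Qed.

Lemma dset_continuous X (A : set X) : A !=set0 -> continuous (dset A).
Proof.
by move=> A0; apply: (@lip_continuous _ _ 1) => // x y; rewrite mul1r dset_lip.
Qed.

(** Compactness makes the infimum in [dset] attained. The enlargement is then a sublevel set of a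
    continuous function, hence closed and Borel. *)
Lemma enlarge_dset X (S : set X) e : compact S -> S !=set0 ->
  enlarge S e = [set x | dset S x <= e].
Proof.
move=> cS S0; apply/seteqP; split => [x [y Sy xy]|x /= xe].
  exact: le_trans (dset_le _ Sy) xy.
have [c Sc cmin] := @compact_EVT_min _ _ (mdist x) S S0 cS
  (continuous_subspaceT (@continuous_mdist _ _ x)).
exists c; first by rewrite inE in Sc.
rewrite (le_trans _ xe)//; apply: lb_le_inf.
  by case: S0 => a Sa; exists (mdist x a), a.
by move=> _ [y Sy <-]; apply: cmin; rewrite inE.
Qed.

Lemma enlarge_closed X (S : set X) e : compact S -> closed (enlarge S e).
Proof.
move=> cS; have [->|/set0P S0] := eqVneq S set0.
  rewrite (_ : enlarge _ _ = set0); first exact: closed0.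
  by rewrite -subset0 => x [].
rewrite enlarge_dset// (_ : [set x | _] = dset S @^-1` [set s | s <= e])//.
apply: preimage_closed => [y _|]; first exact: dset_continuous.
exact: closed_le.
Qed.

Lemma subset_enlarge X (A : set X) e : 0 <= e -> A `<=` enlarge A e.
Proof. by move=> e0 x Ax; exists x => //; rewrite mdistxx. Qed.

Lemma enlargeS X (A B : set X) e e' : A `<=` B -> e <= e' ->
  enlarge A e `<=` enlarge B e'.
Proof.
move=> AB ee x [y Ay xy]; exists y; [exact: AB|exact: le_trans ee].
Qed.

Lemma enlarge_enlarge X (A : set X) e e' :
  enlarge (enlarge A e) e' `<=` enlarge A (e + e').
Proof.
move=> x [y [z Az yz] xy]; exists z => //.
by have := metric_triangle x y z; lra.
Qed.

Lemma cdiskS X (p q : X) r s : mdist p q + s <= r -> cdisk q s `<=` cdisk p r.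
Proof.
rewrite /cdisk => h x /= qx; have := metric_triangle p q x; lra.
Qed.

Lemma enlarge_cdisk X (p : X) r e : enlarge (cdisk p r) e `<=` cdisk p (r + e).
Proof.
move=> x [y]; rewrite /cdisk/= => py xy.
by have := metric_triangle p y x; rewrite [mdist y x]metric_sym; lra.
Qed.

Lemma compact_bounded_cdisk X (p : X) (K : set X) : compact K ->
  exists r, K `<=` cdisk p r.
Proof.
move=> cK; have [->|/set0P K0] := eqVneq K set0; first by exists 0.
have [c Kc cmax] := @compact_EVT_max _ _ (mdist p) K K0 cK
  (continuous_subspaceT (@continuous_mdist _ _ p)).
by exists (mdist p c) => x Kx; apply: cmax; rewrite inE.
Qed.

Lemma bcm_compact (M : bcmType R) (K : set M) (p : M) r :
  closed K -> K `<=` cdisk p r -> compact K.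
Proof. by move=> cK; apply: subclosed_compact => //; exact: cdisk_compact. Qed.

Lemma bcm_enlarge_compact (M : bcmType R) (K : set M) e :
  compact K -> compact (enlarge K e).
Proof.
move=> cK; have [r Kr] := compact_bounded_cdisk point cK.
apply: (@bcm_compact _ _ point (r + e)); first exact: enlarge_closed.
by apply: subset_trans (@enlarge_cdisk _ _ _ _); exact: enlargeS.
Qed.

Lemma metric_compact_closed X (K : set X) : compact K -> closed K.
Proof. by apply: compact_closed; exact: metric_hausdorff. Qed.

Lemma near_mdist_lt X (x : X) e : 0 < e -> \forall y \near x, mdist x y < e.
Proof. by move=> e0; apply: metricType_numDomainType.cvgr_dist_lt. Qed.

Lemma nbhs_mdist_sub X (x : X) (U : set X) : nbhs x U ->
  exists2 e, 0 < e & forall y, mdist x y < e -> U y.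
Proof. by move=> /metricType_numDomainType.nbhs_mdistP[e /= e0 eU]; exists e. Qed.

(** Each point of [K] has a ball missing [A]; half its radius bounds the distance to [A] on a whole
    neighbourhood, and the near-covering form of compactness makes the bound uniform. *)
Lemma compact_closed_separated X (K A : set X) : compact K -> closed A ->
  K `&` A = set0 ->
  exists2 e, 0 < e & forall x y, K x -> A y -> e <= mdist x y.
Proof.
move=> /compact_near_coveringP cK cA KA.
have : \forall e \near 0^'+, K `<=` [set x | forall y, A y -> e <= mdist x y].
  apply: cK => x Kx.
  have /nbhs_mdist_sub[e e0 eA] : nbhs x (~` A).
    apply: open_nbhs_nbhs; split; first exact: closed_openC.
    by move=> Ax; have : set0 x by rewrite -KA.
  have e20 : 0 < e / 2 by lra.
  exists ([set x' | mdist x x' < e / 2], [set i | i <= e / 2]) => /=.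
    by split; [exact: near_mdist_lt|exact: nbhs_right_le].
  move=> [x' i]/= [xx' ie] y Ay; rewrite leNgt; apply/negP => x'y.
  by apply: (eA y) => //; have := metric_triangle x x' y; lra.
move=> H; near (0 : R)^'+ => e; exists e; first by near: e; exact: nbhs_right_gt.
have /= He := near H e; move=> x y Kx; apply: He => //.
Unshelve. all: by end_near. Qed.

Lemma compact_finite_net X (K : set X) e : compact K -> 0 < e ->
  exists s : seq X, (forall c, c \in s -> K c) /\
    forall x, K x -> exists2 c, c \in s & mdist c x < e.
Proof.
move=> /compact_near_coveringP cK e0.
(* The filter of finite lists ordered by inclusion: near [x], every list containing [x] works, so
   near-covering compactness yields one list for all of [K]. *)
pose F : set_system (seq X) :=
  filter_from [set: seq X] (fun s => [set t | {subset s <= t}]).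
have FF : Filter F.
  apply: filter_from_filter; first by exists [::].
  move=> s t _ _; exists (s ++ t) => // u stu.
  by split => x xs; apply: stu; rewrite mem_cat xs ?orbT.
have [s _ sK] : F [set s | K `<=` [set x | exists2 c, c \in s /\ K c & mdist c x < e]].
  apply: (cK _ F (fun s x => exists2 c, c \in s /\ K c & mdist c x < e)) => x Kx.
  exists (ball x e, [set t | x \in t]) => /=.
    split; first exact: nbhsx_ballx.
    by exists [:: x] => // t /= tx; apply: tx; rewrite mem_head.
  by move=> [y t]/=; rewrite ballEmdist => -[/= xy xt]; exists x.
exists [seq c <- s | `[<K c>]]; split => [c|x Kx].
  by rewrite mem_filter => /andP[/asboolP].
have [c [cs Kc] cx] := sK s (fun=> id) x Kx.
by exists c => //; rewrite mem_filter cs andbT; exact/asboolP.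
Qed.

End metric_basics.

(** A single index [k] controls both the radius and the precision, so conditions over all [r] and
    [e] reduce to countably many. *)
Lemma nat_large {R : realType} (r e : R) : 0 < e ->
  exists k : nat, r <= k%:R /\ k.+1%:R^-1 <= e.
Proof.
move=> e0; exists (maxn (Num.truncn `|r|).+1 (Num.truncn e^-1).+1); split.
  rewrite (le_trans (ler_norm _))// (le_trans (ltW (truncnS_gt _)))//.
  by rewrite ler_nat leq_maxl.
rewrite invf_ple ?posrE// (le_trans (ltW (truncnS_gt _)))//.
by rewrite ler_nat leqW// leq_maxr.
Qed.

Lemma near_seq (T : eqType) (s : seq T) (I : Type) (F : set_system I)
    (P : T -> I -> Prop) : Filter F ->
  (forall c, c \in s -> \forall n \near F, P c n) ->
  \forall n \near F, forall c, c \in s -> P c n.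
Proof.
move=> FF; elim: s => [_|c s IH H]; first by apply: filterE => n c.
have := IH (fun d ds => H d (@mem_behead _ (c :: s) d ds)).
apply: filterS2 (H c (mem_head _ _)) => n Pc Ps d.
by rewrite inE => /orP[/eqP->|/Ps].
Qed.

Lemma mball_open {R : realType} (X : metricType R) (x : X) (e : R) :
  open [set y | mdist x y < e].
Proof.
rewrite (_ : [set y | _] = mdist x @^-1` [set s | s < e])//.
by apply: open_comp => [y _|]; [exact: continuous_mdist|exact: open_lt].
Qed.

(** * The lower integral defining the local metrics *)

Section local_integral.
Context {R : realType}.
Local Open Scope ereal_scope.
Let RT := measurableTypeR R.
Let mu : {measure set RT -> \bar R} := lebesgue_measure.
Implicit Type D : R -> \bar R.

Let w D (r : R) := (expR (- r))%:E * mine 1 (D r).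

Let w_ge0 D : (forall r, 0 <= D r) -> forall r, 0 <= w D r.
Proof. by move=> D0 r; rewrite mule_ge0// ?lee_fin ?expR_ge0// le_min D0 lee01. Qed.

Let w_le D r : w D r <= (expR (- r))%:E.
Proof.
by rewrite -[leRHS]mule1 lee_wpmul2l ?lee_fin ?expR_ge0// ge_min lexx.
Qed.

Import HBNNSimple.

Lemma local_integral_ge0 D : (forall r, 0 <= D r) -> 0 <= local_integral D.
Proof. by move=> D0; apply: integral_ge0 => r _; exact: w_ge0. Qed.

Let local_integralE D : (forall r, 0 <= D r) ->
  local_integral D = ereal_sup [set sintegral mu h |
    h in [set h : {nnsfun RT >-> R} |
      forall x, (h x)%:E <= (w D \_ `[0%R, +oo[) x]].
Proof. by move=> D0; rewrite /local_integral ge0_integralE// => r _; exact: w_ge0. Qed.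

(* No measurability of [D] is assumed: the integral is then a lower integral,
   which still detects a lower bound of [D] on an interval. *)
Lemma local_integral_small D (a b c : R) : (forall r, 0 <= D r) ->
  (0 <= a < b)%R -> (0 < c <= 1)%R ->
  local_integral D < (c * expR (- b) * (b - a))%:E ->
  exists2 r, (a <= r <= b)%R & D r <= c%:E.
Proof.
move=> D0 /andP[a0 ab] /andP[c0 c1]; apply: contraPP => /forall2NP H.
apply/negP; rewrite -leNgt local_integralE//.
have k0 : (0 <= c * expR (- b))%R by rewrite mulr_ge0// ?expR_ge0// ltW.
pose k := NngNum k0.
have mab : measurable (`[a, b]%classic : set RT) by [].
(* If [D] exceeded [c] on all of [[a, b]], this simple function would lie below the weighted
   integrand, and its integral is exactly the assumed bound. *)
pose h : {nnsfun RT >-> R} := scale_nnsfun (indic_nnsfun R mab) k0.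
apply: ereal_sup_ubound; exists h; last first.
  rewrite -integralT_nnsfun.
  under eq_integral do rewrite /h/= EFinM.
  rewrite ge0_integralZl//.
  - rewrite integral_indic// setIT.
    have -> : mu (`[a, b]%classic : set RT) = (b - a)%:E.
      by have := lebesgue_measure_itv `[a, b]; rewrite /= lte_fin ab -EFinD.
    by rewrite -EFinM.
  - exact/measurable_EFinP/measurable_indic.
  - by move=> x _; rewrite lee_fin.
move=> x; rewrite (_ : h x = (c * expR (- b) * \1_(`[a, b]%classic : set RT) x)%R)//.
rewrite patchE; case: ifPn => [|/negP]; rewrite inE/= in_itv/= andbT => x0.
  rewrite indicE; have [|xab] := boolP (_ \in _); last by rewrite mulr0 w_ge0.
  rewrite inE/= in_itv/= => /andP[ax xb]; rewrite mulr1 /w EFinM muleC.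
  apply: lee_pmul; rewrite ?lee_fin ?expR_ge0 ?(ltW c0)//.
    by rewrite ler_expR lerN2.
  rewrite le_min lee_fin c1/=; have [|/negP] := H x; first by rewrite ax xb.
  by rewrite -ltNge => /ltW.
rewrite indicE memNset ?mulr0//= in_itv/= => /andP[ax _].
by apply: x0; exact: le_trans ax.
Qed.

(** The exponential density of rate 1 is an integrable majorant of all the weighted integrands. *)
Let pdf := @exponential_pdf R 1.

Let w_pdf D x : (forall r, 0 <= D r) -> (w D \_ `[0%R, +oo[) x <= (pdf x)%:E.
Proof.
move=> D0; rewrite /pdf /exponential_pdf !patchE; case: ifPn => // _.
by rewrite mulN1r mul1r; exact: w_le.
Qed.

Let mpdf : measurable_fun setT (EFin \o pdf).
Proof. by apply/measurable_EFinP; have := @measurable_exponential_pdf R 1. Qed.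

Let integral_pdf : \int[mu]_x (pdf x)%:E = 1.
Proof. exact: integral_exponential_pdf. Qed.

Let ipdf : mu.-integrable setT (EFin \o pdf).
Proof. exact: integrable_exponential_pdf. Qed.

Let local_integral_fin D : (forall r, 0 <= D r) ->
  local_integral D \is a fin_num.
Proof.
move=> D0; rewrite ge0_fin_numE ?local_integral_ge0//.
apply: (@le_lt_trans _ _ 1); last exact: ltry.
rewrite local_integralE//; apply: ge_ereal_sup => _ [h /= hw <-].
rewrite -integralT_nnsfun -integral_pdf; apply: ge0_le_integral => //.
- by move=> x _; rewrite lee_fin.
- exact/measurable_EFinP.
- by move=> x _; rewrite (le_trans (hw x))// w_pdf.
Qed.

(* Near-optimal simple functions below the (possibly non-measurable) integrands
   are measurable, so dominated convergence applies to them. *)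
Lemma local_integral_cvg0 (D_ : nat -> R -> \bar R) (B : set R) :
  (forall n r, 0 <= D_ n r) -> countable B ->
  (forall r, (0 <= r)%R -> ~ B r -> D_ n r @[n --> \oo] --> 0) ->
  local_integral (D_ n) @[n --> \oo] --> 0.
Proof.
move=> D0 cB DB.
have /choice[h hD] : forall n, exists h : {nnsfun RT >-> R},
    (forall x, (h x)%:E <= (w (D_ n) \_ `[0%R, +oo[) x) /\
    local_integral (D_ n) <= (\int[mu]_x (h x)%:E) + (n.+1%:R^-1)%:E.
  move=> n.
  have e0 : (0 < n.+1%:R^-1 :> R)%R by rewrite invr_gt0.
  have := local_integral_fin (D0 n); rewrite local_integralE// => finn.
  have [_ [h hw <-] hlt] := ub_ereal_sup_adherent e0 finn.
  exists h; split => //.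
  by rewrite integralT_nnsfun -leeBlDr// ltW.
have mh n : measurable_fun setT (EFin \o h n) by exact/measurable_EFinP.
have h0 n x : (0 <= h n x)%R by [].
(* For [x >= 0] off [B], [h n x] is squeezed between 0 and [D_ n x]; for [x < 0] it vanishes because
   the integrand is extended by 0. *)
have ae0 : {ae mu, forall x, setT x -> (h n x)%:E @[n --> \oo] --> (cst 0 : R -> \bar R) x}.
  exists B; split; first exact: countable_measurable.
    exact: countable_lebesgue_measure0.
  move=> x /= /not_implyP[_] /= hx; apply: contrapT => nB; apply: hx.
  have [x0|x0] := leP 0%R x; last first.
    rewrite (_ : (fun n => _) = cst 0); first exact: cvg_cst.
    apply/funext => n; apply/eqP; rewrite eq_le; apply/andP; split; last first.
      by rewrite lee_fin; exact: h0.
    rewrite (le_trans ((hD n).1 x))// patchE memNset//= in_itv/= andbT.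
    by apply/negP; rewrite -ltNge.
  change ((h n x)%:E @[n --> \oo] --> (0 : \bar R)).
  apply: (@squeeze_cvge _ _ _ _ (cst 0) (fun n => (h n x)%:E) (fun n => D_ n x)).
  - apply: nearW => n; rewrite lee_fin; apply/andP; split; first exact: h0.
    rewrite (le_trans ((hD n).1 x))//.
    rewrite patchE mem_set/=; last by rewrite in_itv/= x0.
    rewrite /w -[leRHS]mul1e; apply: lee_pmul.
    + by rewrite lee_fin expR_ge0.
    + by rewrite le_min D0 lee01.
    + by rewrite lee_fin expR_le1 oppr_le0.
    + by rewrite ge_min lexx orbT.
  - exact: cvg_cst.
  - exact: DB.
have hpdf : {ae mu, forall x n, setT x -> `|(h n x)%:E| <= (pdf x)%:E}.
  apply: aeW => x n _; rewrite gee0_abs ?lee_fin//.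
  by rewrite -lee_fin (le_trans ((hD n).1 x))// w_pdf.
have [_ _ hcvg] := dominated_convergence measurableT mh
  (@measurable_cst _ _ RT (\bar R) setT 0) ae0 ipdf hpdf.
have sqz : \forall n \near \oo,
    0 <= local_integral (D_ n) <= (\int[mu]_x (h n x)%:E) + (n.+1%:R^-1)%:E.
  by apply: nearW => n; rewrite local_integral_ge0//= (hD n).2.
have lim0 : (\int[mu]_x (h n x)%:E) + (n.+1%:R^-1)%:E @[n --> \oo] --> 0.
  rewrite -[X in _ --> X]adde0; apply: cvgeD => //.
    by move: hcvg; rewrite integral_cst// mul0e.
  by apply/fine_cvgP; split; [exact: nearW|exact: cvg_harmonic].
exact: (squeeze_cvge sqz (cvg_cst 0) lim0).
Qed.

End local_integral.

(** * Gluing metric spaces *)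

Section cross_distance.
Context {R : realType}.

(* [del] is the restriction to [X * Y] of a pseudometric on the disjoint union
   of [X] and [Y] that extends both metrics. *)
Record is_cross (X Y : metricType R) (del : X -> Y -> R) : Prop := {
  crossl : forall x x' y, del x y <= mdist x x' + del x' y;
  crossr : forall x y y', del x y <= del x y' + mdist y' y;
  crossX : forall x x' y, mdist x x' <= del x y + del x' y;
  crossY : forall x y y', mdist y y' <= del x y + del x y' }.

Lemma cross_ge0 (X Y : metricType R) (del : X -> Y -> R) : is_cross del ->
  forall x y, 0 <= del x y.
Proof. by move=> cd x y; have := crossX cd x x y; rewrite mdistxx; lra. Qed.

Lemma cross_emb (X Y Z : metricType R) (f : isoEmb X Z) (g : isoEmb Y Z) :
  is_cross (fun x y => mdist (f x) (g y)).
Proof.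
split=> [x x' y|x y y'|x x' y|x y y'].
- by rewrite -(isoEmbP f); exact: metric_triangle.
- by rewrite -(isoEmbP g); exact: metric_triangle.
- by rewrite -(isoEmbP f) [mdist (f x') _]metric_sym; exact: metric_triangle.
- by rewrite -(isoEmbP g) [mdist (f x) (g y)]metric_sym; exact: metric_triangle.
Qed.

Lemma cross_mdist (X : metricType R) : is_cross (@mdist R X).
Proof.
split=> [x x' y|x y y'|x x' y|x y y']; do ?exact: metric_triangle.
- by rewrite [mdist x' y]metric_sym; exact: metric_triangle.
- by rewrite [mdist x y]metric_sym; exact: metric_triangle.
Qed.

Section weighted_gluing.
Context {X Y : metricType R} (W : X -> Y -> R -> Prop).
Hypothesis W0 : exists x y w, W x y w.
Hypothesis WX : forall x1 y1 w1 x2 y2 w2, W x1 y1 w1 -> W x2 y2 w2 ->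
  mdist x1 x2 <= w1 + w2 + mdist y1 y2.
Hypothesis WY : forall x1 y1 w1 x2 y2 w2, W x1 y1 w1 -> W x2 y2 w2 ->
  mdist y1 y2 <= w1 + w2 + mdist x1 x2.

Let cost x y := [set t | exists x' y' w, W x' y' w /\
  t = mdist x x' + w + mdist y' y].

(** [W x y w] reads as a bridge of length [w] between [x] and [y], and only paths over one bridge
    compete here. [WX] and [WY] say that crossing one bridge and returning over another is never a
    shortcut. *)
Definition glue_dist x y : R := inf (cost x y).

Let W_ge0 x y w : W x y w -> 0 <= w.
Proof. by move=> Ww; have := WX Ww Ww; rewrite !mdistxx; lra. Qed.

Let glue_le x y x' y' w : W x' y' w ->
  glue_dist x y <= mdist x x' + w + mdist y' y.
Proof.
move=> Ww; apply: ge_inf; last by exists x', y', w.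
exists 0 => _ [x1 [y1 [w1 [W1 ->]]]].
by rewrite !addr_ge0 ?mdist_ge0// (W_ge0 W1).
Qed.

Let le_glue x y (b : R) : (forall x' y' w, W x' y' w ->
  b <= mdist x x' + w + mdist y' y) -> b <= glue_dist x y.
Proof.
move=> H; apply: lb_le_inf.
  by have [x' [y' [w Ww]]] := W0; exists (mdist x x' + w + mdist y' y), x', y', w.
by move=> _ [x1 [y1 [w1 [W1 ->]]]]; exact: H.
Qed.

Lemma glue_le_weight x y w : W x y w -> glue_dist x y <= w.
Proof. by move=> /(glue_le x y); rewrite !mdistxx add0r addr0. Qed.

Lemma cross_glue : is_cross glue_dist.
Proof.
split=> [x x' y|x y y'|x x' y|x y y'].
- rewrite -lerBlDl; apply: le_glue => x1 y1 w1 W1.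
  by have := glue_le x y W1; have := metric_triangle x x' x1; lra.
- rewrite -lerBlDr; apply: le_glue => x1 y1 w1 W1.
  by have := glue_le x y W1; have := metric_triangle y1 y' y; lra.
- rewrite -lerBlDr; apply: le_glue => x1 y1 w1 W1.
  rewrite lerBlDr -lerBlDl; apply: le_glue => x2 y2 w2 W2.
  have := WX W1 W2; have := metric_triangle x x1 x'.
  have := metric_triangle x1 x2 x'; have := metric_triangle y1 y y2.
  by rewrite [mdist x2 x']metric_sym [mdist y y2]metric_sym; lra.
- rewrite -lerBlDr; apply: le_glue => x1 y1 w1 W1.
  rewrite lerBlDr -lerBlDl; apply: le_glue => x2 y2 w2 W2.
  have := WY W1 W2; have := metric_triangle y y1 y'.
  have := metric_triangle y1 y2 y'; have := metric_triangle x1 x x2.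
  by rewrite [mdist y y1]metric_sym [mdist x1 x]metric_sym; lra.
Qed.

End weighted_gluing.

End cross_distance.

(** * Metric quotient of a pseudometric *)

Section metric_quotient.
Context {R : realType}.

Record pseudometric (S : Type) := Pseudometric {
  pdist :> S -> S -> R;
  pdistxx : forall x, pdist x x = 0;
  pdistC : forall x y, pdist x y = pdist y x;
  pdist_triangle : forall y x z, pdist x z <= pdist x y + pdist y z }.

Context {S : choiceType} (D : pseudometric S).

Lemma pdist_eq0 x y x' y' : D x x' = 0 -> D y y' = 0 -> D x y = D x' y'.
Proof.
move=> xx yy.
have := pdist_triangle D x' x y; have := pdist_triangle D y' x' y.
have := pdist_triangle D x x' y'; have := pdist_triangle D y x y'.
by rewrite [D x' x]pdistC [D y' y]pdistC xx yy; lra.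
Qed.

(** As [choose] depends only on the extension of the predicate, points at distance 0 share their
    representative, and the quotient can be a subtype: the fixed points of [canon]. *)
Definition canon (x : S) : S := choose (fun y => D x y == 0) x.

Lemma canonP x : D x (canon x) = 0.
Proof. by apply/eqP; apply: (@chooseP _ (fun y => D x y == 0)); rewrite pdistxx. Qed.

Lemma canon_eq x y : D x y = 0 -> canon x = canon y.
Proof.
move=> xy; rewrite /canon.
rewrite (@eq_choose _ (fun z => D x z == 0) (fun z => D y z == 0)); last first.
  by move=> z; rewrite (pdist_eq0 xy (pdistxx D z)).
by apply: choose_id; rewrite ?pdistxx// pdistC xy.
Qed.

Definition mquot : Type := {x : S | canon x == x}.

HB.instance Definition _ := Choice.on mquot.

Let qdist (x y : mquot) : R := D (val x) (val y).

Let qdistxx x : qdist x x = 0. Proof. exact: pdistxx. Qed.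

Let qdist_positivity x y : qdist x y = 0 -> x = y.
Proof.
by move=> /canon_eq xy; apply: val_inj; rewrite -(eqP (valP x)) -(eqP (valP y)).
Qed.

Let qdistC x y : qdist x y = qdist y x. Proof. exact: pdistC. Qed.

Let qdist_triangle y x z : qdist x z <= qdist x y + qdist y z.
Proof. exact: pdist_triangle. Qed.

HB.instance Definition _ := isMetric.Build R mquot
  qdistxx qdist_positivity qdistC qdist_triangle.

Lemma canonK x : canon (canon x) == canon x.
Proof. by apply/eqP/esym/canon_eq/canonP. Qed.

Definition to_mquot (x : S) : mquot := exist _ (canon x) (canonK x).

Lemma mdist_to_mquot x y : mdist (to_mquot x) (to_mquot y) = D x y.
Proof. by rewrite (pdist_eq0 (canonP x) (canonP y)). Qed.

Lemma to_mquotP (q : mquot) : exists x, q = to_mquot x.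
Proof. by exists (val q); apply: val_inj; rewrite /= (eqP (valP q)). Qed.

End metric_quotient.

(** * Amalgam of a family of spaces along [X] *)

Section amalgam.
Context {R : realType} {I : choiceType} (T : I -> metricType R)
  (X : pmetricType R) (del : forall i, T i -> X -> R).
Hypothesis cdel : forall i, is_cross (@del i).

Let S : Type := {i : I & T i}.
Let dl (u : S) := @del (tag u) (tagged u).

Let E (u v : S) : R := inf [set dl u x + dl v x | x in setT].

Definition amalgam_dist (u v : S) : R :=
  if tag u == tag v then mdist (tagged u) (tagged_as u v) else E u v.

Let E_le u v x : E u v <= dl u x + dl v x.
Proof.
apply: ge_inf; last by exists x.
by exists 0 => _ [y _ <-]; rewrite addr_ge0//; apply: cross_ge0.
Qed.

Let le_E u v b : (forall x, b <= dl u x + dl v x) -> b <= E u v.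
Proof.
move=> H; apply: lb_le_inf; first by exists (dl u point + dl v point), point.
by move=> _ [y _ <-]; exact: H.
Qed.

Let EC u v : E u v = E v u.
Proof. by rewrite /E; under eq_imagel do rewrite addrC. Qed.

Lemma amalgam_same i (a b : T i) :
  amalgam_dist (Tagged T a) (Tagged T b) = mdist a b.
Proof. by rewrite /amalgam_dist /= eqxx tagged_asE. Qed.

Lemma amalgam_neq i j (a : T i) (b : T j) : i != j ->
  amalgam_dist (Tagged T a) (Tagged T b) = E (Tagged T a) (Tagged T b).
Proof. by move=> ij; rewrite /amalgam_dist/= (negbTE ij). Qed.

(** The passage from [x] to [y] through [v] is at least as long as the distance of [x] and [y] in
    [X] by [crossY], so both [u] and [w] can be joined through [y]. *)
Let E_triangle u v w : E u w <= E u v + E v w.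
Proof.
rewrite -lerBlDr; apply: le_E => x; rewrite lerBlDr -lerBlDl; apply: le_E => y.
rewrite lerBlDl; apply: le_trans (E_le _ _ y) _.
have := crossr (cdel _) (tagged u) y x; have := crossY (cdel _) (tagged v) x y.
by rewrite -!/(dl _ _); lra.
Qed.

Let E_same i (a b : T i) : mdist a b <= E (Tagged T a) (Tagged T b).
Proof. by apply: le_E => x; exact: crossX. Qed.

Let E_lip i (a b : T i) v : E (Tagged T a) v <= mdist a b + E (Tagged T b) v.
Proof.
rewrite -lerBlDl; apply: le_E => x; rewrite lerBlDl.
apply: le_trans (E_le _ _ x) _; rewrite addrA lerD2r.
exact: crossl.
Qed.

Lemma amalgamxx u : amalgam_dist u u = 0.
Proof. by case: u => i a; rewrite amalgam_same mdistxx. Qed.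

Lemma amalgamC u v : amalgam_dist u v = amalgam_dist v u.
Proof.
case: u v => i a [j b]; have [ij|ij] := eqVneq i j.
  by case: _ / ij b => b; rewrite !amalgam_same metric_sym.
by rewrite !amalgam_neq// 1?eq_sym// EC.
Qed.

Lemma amalgam_triangle v u w :
  amalgam_dist u w <= amalgam_dist u v + amalgam_dist v w.
Proof.
case: u v w => i a [j b] [k c].
have [ij|ij] := eqVneq i j.
  case: _ / ij b => b; have [ik|ik] := eqVneq i k.
    by case: _ / ik c => c; rewrite !amalgam_same; exact: metric_triangle.
  by rewrite amalgam_same !(amalgam_neq _ _ ik); exact: E_lip.
have [jk|jk] := eqVneq j k.
  case: _ / jk c => c; rewrite amalgam_same !(amalgam_neq _ _ ij).
  by rewrite EC addrC metric_sym (EC (Tagged T a)); exact: E_lip.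
rewrite (amalgam_neq _ _ ij) (amalgam_neq _ _ jk).
have [ik|ik] := eqVneq i k.
  case: _ / ik c jk => c jk; rewrite amalgam_same.
  exact: le_trans (E_same _ _) (E_triangle _ _ _).
by rewrite (amalgam_neq _ _ ik); exact: E_triangle.
Qed.

Definition amalgam : pseudometric (R := R) {i : I & T i} :=
  Pseudometric amalgamxx amalgamC amalgam_triangle.

(** The hypothesis on [b] says that it is seen from [X] exactly as the point [x0] is; the infimum is
    then attained at [x0]. This serves for the component that is a copy of [X] itself. *)
Lemma amalgam_dist_cross i j (a : T i) (b : T j) (x0 : X) :
  i != j -> (forall x, del b x = mdist x x0) ->
  amalgam_dist (Tagged T a) (Tagged T b) = del a x0.
Proof.
move=> ij hb; rewrite amalgam_neq//; apply/eqP; rewrite eq_le; apply/andP; split.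
  by apply: le_trans (E_le _ _ x0) _; rewrite {2}/dl/= hb mdistxx addr0.
apply: le_E => x; rewrite /dl/= hb.
exact: crossr.
Qed.

Definition amalgam_in i (a : T i) : mquot amalgam := to_mquot amalgam (Tagged T a).

Lemma amalgam_in_isometry i (a b : T i) :
  mdist (amalgam_in a) (amalgam_in b) = mdist a b.
Proof. by rewrite mdist_to_mquot/= amalgam_same. Qed.

Definition amalgam_emb i : isoEmb (T i) (mquot amalgam) :=
  IsoEmb (@amalgam_in_isometry i).

Lemma amalgam_embP (q : mquot amalgam) : exists i a, q = amalgam_emb i a.
Proof. by have [[i a] ->] := to_mquotP q; exists i, a. Qed.

End amalgam.

(** * Compactness from approximation by compact sets *)

Section compactness_by_approximation.
Context {R : realType} {Q : metricType R}.

(** Near a point that is not a cluster point, some member of [F] keeps a positive distance.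
    Near-covering compactness along the filter of pairs (small member, small radius) makes both
    uniform over [K]. *)
Lemma no_cluster_separated (K : set Q) (F : set_system Q) : Filter F ->
  compact K -> K `&` cluster F = set0 ->
  exists A e, [/\ F A, 0 < e & forall x y, K x -> A y -> e < mdist x y].
Proof.
move=> FF /compact_near_coveringP cK KF.
pose G : set_system (set Q * R) :=
  filter_from [set p | F p.1 /\ 0 < p.2]
    (fun p => [set q | q.1 `<=` p.1 /\ q.2 <= p.2]).
have FG : Filter G.
  apply: filter_from_filter; first by exists (setT, 1); split => //=; exact: filterT.
  move=> [A e] [B d] /= [FA e0] [FB d0]; exists (A `&` B, Num.min e d) => /=.
    by split; [exact: filterI|rewrite lt_min e0].
  move=> [C c]/= [CAB]; rewrite le_min => /andP[ce cd].
  by split; split => // x /CAB[].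
have [[A e] /= [FA e0] AeK] :
    G [set p | K `<=` (fun x => forall y, p.1 y -> p.2 < mdist x y)].
  apply: (cK _ G (fun p x => forall y, p.1 y -> p.2 < mdist x y)) => x Kx.
  have : ~ cluster F x by move=> Fx; have : set0 x by rewrite -KF.
  move=> /existsNP[A /existsNP[V /not_implyP[FA /not_implyP[Vx]]]] AV.
  have [e e0 eV] := nbhs_mdist_sub Vx.
  exists ([set y | mdist x y < e / 2], [set p | p.1 `<=` A /\ p.2 <= e / 2]) => /=.
    split; first by apply: near_mdist_lt; lra.
    by exists (A, e / 2) => //=; split => //; lra.
  move=> [x' [B d]]/= [xx' [BA de]] y By; rewrite ltNge; apply/negP => x'y.
  apply: AV; exists y; split; first exact: BA.
  by apply: eV; have := metric_triangle x x' y; lra.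
by exists A, e; split => // x y Kx; apply: (AeK (A, e)) => //=; split.
Qed.

(** A filter on [B] that does not cluster in [K] has a member farther than some [e] from [K]; that
    part of [B] lies in the compact set [C], where the filter must cluster. *)
Lemma compact_approx (B K : set Q) : closed B -> compact K ->
  (forall e, 0 < e -> exists2 C, compact C & B `<=` C `|` enlarge K e) ->
  compact B.
Proof.
move=> cB cK BCK F FF FB.
have FBsub : cluster F `<=` B.
  by move=> x Fx; apply: cB => V Vx; exact: Fx.
have [KF|/set0P[x [Kx Fx]]] := eqVneq (K `&` cluster F) set0; last first.
  by exists x; split => //; exact: FBsub.
have [A [e [FA e0 eKA]]] := no_cluster_separated _ cK KF.
have [C cC BC] := BCK _ e0.
have FC : F C.
  apply: filterS (filterI FA FB) => y [Ay /BC[//|[x Kx yx]]].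
  by have := eKA _ _ Kx Ay; rewrite metric_sym ltNge yx.
have [x [_ Fx]] := cC F FF FC.
by exists x; split => //; exact: FBsub.
Qed.

End compactness_by_approximation.

(** * Gluing a sequence of spaces to [X] *)

Section sequential_gluing.
Context {R : realType} (X : bcmType R) (Y : nat -> bcmType R)
  (del : forall n, Y n -> X -> R).
Hypothesis cdel : forall n, is_cross (@del n).
Hypothesis del_root : forall n, del (rootpt (Y n)) (rootpt X) = 0.
Hypothesis del_near : forall r e, 0 < e -> \forall n \near \oo,
  forall u : Y n, mdist (rootpt (Y n)) u <= r -> exists x, del u x <= e.

(** Index 0 is [X], with its own metric as cross-distance to itself, so that [X] enters the amalgam
    like every other component. *)
Let T (k : nat) : bcmType R := if k is n.+1 then Y n else X.
Let delT (k : nat) : T k -> X -> R :=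
  match k return T k -> X -> R with 0 => @mdist R X | n.+1 => @del n end.
Let cdelT k : is_cross (@delT k).
Proof. by case: k => [|n]; [exact: cross_mdist|exact: cdel]. Qed.

Local Notation Q := (mquot (amalgam cdelT)).
Let F k : isoEmb (T k) Q := amalgam_emb cdelT k.

Let cross_F n (u : Y n) x : mdist (F n.+1 u) (F 0%N x) = del u x.
Proof.
rewrite mdist_to_mquot.
apply: (@amalgam_dist_cross _ _ T X delT cdelT n.+1 0%N u x x) => //= y.
exact: metric_sym.
Qed.

Let root_F k : F k (rootpt (T k)) = F 0%N (rootpt X).
Proof.
case: k => [//|n]; apply: mdist_positivity.
by rewrite cross_F del_root.
Qed.

Let pt : mquot (amalgam cdelT) := F 0%N (rootpt X).

Let cdisk_pt_compact r : compact (cdisk pt r).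
Proof.
have cF k s : compact (F k @` cdisk (rootpt (T k)) s).
  apply: continuous_compact; last exact: cdisk_compact.
  by apply: continuous_subspaceT; exact: isoEmb_continuous.
apply: (@compact_approx _ _ _ (F 0%N @` cdisk (rootpt X) (r + 1))).
- exact: cdisk_closed.
- exact: (cF 0%N).
move=> e e0.
(* Capping by 1 keeps the partners in [X] of points of the [r]-ball inside the ball of radius
   [r + 1]. Only finitely many components, those up to [N], need their own compact piece. *)
pose e' := Num.min e 1.
have e'0 : 0 < e' by rewrite lt_min e0/=.
have [N _ HN] := del_near r e'0.
exists (\big[setU/set0]_(k < N.+1) F k @` cdisk (rootpt (T k)) r).
  by apply: bigsetU_compact => k _; exact: cF.
move=> q qr; have [k [a qa]] := amalgam_embP q; move: qr; rewrite qa => ar.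
have {}ar : mdist (rootpt (T k)) a <= r.
  by rewrite -(isoEmbP (F k)) root_F.
have [kN|Nk] := ltnP k N.+1.
  left; rewrite -(bigcup_mkord N.+1 (fun k => F k @` cdisk (rootpt (T k)) r)).
  by exists k => //; exists a.
right; case: k => [//|n] in a qa ar Nk *.
have [x ax] := HN n Nk a ar.
have := ax; rewrite le_min => /andP[axe ax1].
exists (F 0%N x); last by rewrite -/(F _) cross_F.
exists x => //; rewrite /cdisk/=.
have := crossl (cdel n) (rootpt (Y n)) a x.
have := crossY (cdel n) (rootpt (Y n)) (rootpt X) x; rewrite del_root.
by move: ar => /=; lra.
Qed.

Let cdisk_Q_compact (q : mquot (amalgam cdelT)) r : compact (cdisk q r).
Proof.
apply: (@subclosed_compact _ _ (cdisk pt (mdist pt q + r))).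
- exact: cdisk_closed.
- exact: cdisk_pt_compact.
- exact: cdiskS.
Qed.

Lemma sequential_gluing : exists (M : bcmType R) (f : isoEmb X M)
    (f_ : forall n, isoEmb (Y n) M),
  [/\ root_preserving f, forall n, root_preserving (f_ n) &
      forall n u x, mdist (f_ n u) (f x) = del u x].
Proof.
pose M : bcmType R := HB.pack Q (isPointed.Build Q pt)
  (isBoundedlyCompact.Build R Q cdisk_Q_compact).
exists M, (F 0%N : isoEmb X M), (fun n => F n.+1 : isoEmb (Y n) M).
by split => // n; exact: (root_F n.+1).
Qed.

End sequential_gluing.

(** * Fell convergence *)

Section fell.

(** Neighbourhoods contain finite intersections of subbasic sets, so convergence need only be tested
    on the [miss] and [hit] sets. *)
Lemma fell_cvgP (X : topologicalType) (F : set_system (closedSet X))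
    (A : closedSet X) : Filter F ->
  F --> A <->
  (forall K, compact K -> sval A `&` K = set0 -> F (miss K)) /\
  (forall U, open U -> sval A `&` U !=set0 -> F (hit U)).
Proof.
move=> FF; split=> [FA|[FK FU] N].
  have sub B : ([set miss K | K in compact] `|` [set hit U | U in open]) B ->
      B A -> F B.
    move=> sB BA; apply: FA; rewrite /= nbhsE; exists B => //.
    split => //; exists [set B]; last first.
      by rewrite predeqE => C; split=> [[_ ->]|] //; exists B.
    move=> _ ->; exists [fset B]%fset.
      by move=> C; rewrite inE inE => /eqP->.
    by rewrite predeqE => C; split=> [|BC D]; [apply; rewrite /= inE|rewrite /= inE => /eqP->].
  split=> [K cK AK|U oU AU]; apply: sub => //; first by left; exists K.
  by right; exists U.
rewrite /= nbhsE => -[_ [[B sB <-] [C BC CA]] sUBA].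
rewrite nbhs_filterE; apply: filterS sUBA _; apply: (@filterS _ _ _ C).
  by move=> D CD; exists C.
have /sB [D sD IDeC] := BC; rewrite -IDeC; apply: filter_bigI => E DE.
have EA : E A by move: CA; rewrite -IDeC => /(_ _ DE).
have /sD := DE; rewrite inE => -[[K cK KE]|[U oU UE]].
  by move: EA; rewrite -KE; exact: FK.
by move: EA; rewrite -UE; exact: FU.
Qed.

Section fell_truncation.
Context {R : realType} {M : bcmType R} (A_ : nat -> closedSet M) (A : closedSet M)
  (p_ : nat -> M) (p : M).
Hypothesis A_A : A_ n @[n --> \oo] --> A.
Hypothesis p_p : p_ n @[n --> \oo] --> p.

Let p_near e : 0 < e -> \forall n \near \oo, mdist p (p_ n) < e.
Proof. by move=> e0; apply: metricType_numDomainType.cvgr_dist_lt. Qed.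

(** This side has no exceptional radius: by compactness, points of [A] barely outside the ball are
    close to points of [A] inside it. *)
Lemma fell_trunc_upper (r e : R) : 0 < e -> \forall n \near \oo,
  sval (A_ n) `&` cdisk (p_ n) r `<=` enlarge (sval A `&` cdisk p r) e.
Proof.
move=> e0; have cA : closed (sval A) := svalP A.
pose good h := sval A `&` cdisk p (r + 1) `<=`
    [set x | mdist p x <= r + h ->
             exists2 y, (sval A `&` cdisk p r) y & mdist x y < e].
have H : \forall h \near 0^'+, good h.
  have /compact_near_coveringP/near_covering_withinP :
      compact (sval A `&` cdisk p (r + 1)).
    by rewrite setIC; apply: compact_closedI => //; exact: cdisk_compact.
  apply => x [Ax _].
  have [xr|rx] := leP (mdist p x) r.
    exists ([set y | mdist x y < e], setT) => /=.
      by split; [exact: near_mdist_lt|exact: filterT].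
    move=> [y h] [/= xy _] _ _; exists x => //.
    by rewrite metric_sym.
  (* Such an [x] is outside the ball by [2 * k]: points within [k] of it violate the radius
     condition as soon as [h < k]. *)
  pose k := (mdist p x - r) / 2; have k0 : 0 < k by rewrite /k; lra.
  exists ([set y | mdist x y < k], [set h | h < k]) => /=.
    by split; [exact: near_mdist_lt|exact: nbhs_right_lt].
  move=> [y h] [/= xy hk] _; have := metric_triangle p y x.
  by rewrite [mdist y x]metric_sym; move: xy hk; rewrite /k; lra.
have [h [h0 h1 Hh]] : exists h, [/\ 0 < h, h < 1 & good h].
  near (0 : R)^'+ => h; exists h; split; near: h => //.
    exact: nbhs_right_gt.
  exact: nbhs_right_lt.
(* The compact set of potential bad points. It misses [A] by the choice of [h], hence eventually
   misses [A_ n]; the extra [h] in the radius allows for the moving centre. *)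
pose K := cdisk p (r + h) `&`
  [set x | forall y, (sval A `&` cdisk p r) y -> e <= mdist x y].
have KA : sval A `&` K = set0.
  rewrite -subset0 => x [Ax [xr Kx]].
  have xr1 : (sval A `&` cdisk p (r + 1)) x.
    by split => //; move: xr; rewrite /cdisk/=; lra.
  have [y Ay] := Hh x xr1 xr.
  by rewrite ltNge (Kx y Ay).
have cK : compact K.
  apply: compact_closedI; first exact: cdisk_compact.
  rewrite (_ : [set x | _] = \bigcap_(y in sval A `&` cdisk p r)
      (mdist y @^-1` [set s | e <= s])).
    apply: closed_bigI => y _; apply: preimage_closed => [z _|].
      exact: continuous_mdist.
    exact: closed_ge.
  by apply/seteqP; split => x /= Hx y Ay /=; rewrite metric_sym; exact: Hx.
have AK : \forall n \near \oo, sval (A_ n) `&` K = set0.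
  have [missA _] := (fell_cvgP A _).1 A_A; exact: (missA K cK KA).
apply: filterS2 AK (p_near h0) => n AnK pn x [Ax xr].
apply: contrapT => Hx; have : set0 x; last by [].
rewrite -AnK; split => //; split.
  by apply: cdiskS xr; lra.
move=> y Ay; rewrite leNgt; apply/negP => xy.
by apply: Hx; exists y => //; exact: ltW.
Unshelve. all: by end_near. Qed.

(** A point of [A] exactly on the sphere of radius [r] may be approximated only from outside the
    ball. A finite net limits the harmful radii to finitely many for a given precision. *)
Lemma fell_trunc_lower (r0 e : R) : 0 < e -> exists B : seq R,
  forall r, r <= r0 -> r \notin B -> \forall n \near \oo,
  sval A `&` cdisk p r `<=` enlarge (sval (A_ n) `&` cdisk (p_ n) r) e.
Proof.
move=> e0; have cA : closed (sval A) := svalP A.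
(* One third for each leg of the path from [x] through a net point [c] and [m c] to a point of
   [A_ n]. *)
pose h := e / 3; have h0 : 0 < h by rewrite /h; lra.
have [|s [sA sn]] := @compact_finite_net _ M (sval A `&` cdisk p r0) h _ h0.
  by rewrite setIC; apply: compact_closedI => //; exact: cdisk_compact.
(* [m c] is a point of [A] near [c] that is closest to [p]. If any point of [A] near [c] lies in the
   [r]-ball, so does [m c], and strictly inside unless [r] is one of the excluded radii. *)
have /choice[m mP] : forall c, exists m, sval A c ->
    (sval A `&` cdisk c h) m /\
    forall x, (sval A `&` cdisk c h) x -> mdist p m <= mdist p x.
  move=> c; have [Ac|nAc] := pselect (sval A c); last by exists c.
  have cAc : compact (sval A `&` cdisk c h).
    by rewrite setIC; apply: compact_closedI => //; exact: cdisk_compact.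
  have Ac0 : sval A `&` cdisk c h !=set0.
    by exists c; split => //; rewrite /cdisk/= mdistxx ltW.
  have [m mA mmin] := @compact_EVT_min _ _ (mdist p) _ Ac0 cAc
    (continuous_subspaceT (@continuous_mdist _ _ p)).
  exists m => _; split; first by rewrite inE in mA.
  by move=> x Ax; apply: mmin; rewrite inE.
exists [seq mdist p (m c) | c <- s] => r rr0 rB.
have : \forall n \near \oo, forall c, c \in s -> mdist p (m c) < r ->
    exists2 b, (sval (A_ n) `&` cdisk (p_ n) r) b & mdist (m c) b < h.
  apply: near_seq => c cs.
  have [_|cr] := leP r (mdist p (m c)); first exact: filterE.
  pose k := Num.min h ((r - mdist p (m c)) / 2).
  have k0 : 0 < k by rewrite lt_min h0/=; lra.
  have [[Am _] _] := mP c (sA c cs).1.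
  have Amk : sval A `&` [set y | mdist (m c) y < k] !=set0.
    by exists (m c); split => //=; rewrite mdistxx.
  have Hn : \forall n \near \oo, sval (A_ n) `&` [set y | mdist (m c) y < k] !=set0.
    have [_ hitA] := (fell_cvgP A _).1 A_A.
    exact: (hitA _ (mball_open (X := M) _ _) Amk).
  apply: filterS2 Hn (p_near k0) => n [b [Ab mb]] pn _.
  have := mb; rewrite /= lt_min => /andP[mbh mbr].
  exists b => //; split => //; rewrite /cdisk/=.
  have := pn; rewrite lt_min => /andP[_ pnr].
  have := metric_triangle (p_ n) p b; have := metric_triangle p (m c) b.
  by rewrite [mdist (p_ n) p]metric_sym; lra.
apply: filterS => n Hn x [Ax xr].
have [|c cs cx] := sn x; first by split => //; exact: le_trans xr rr0.
have [Ac _] := sA c cs; have [[Am cm] mmin] := mP c Ac.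
have mx : mdist p (m c) <= r.
  by apply: le_trans xr; apply: mmin; split => //; exact: ltW.
have [|b Ab mb] := Hn c cs.
  rewrite lt_neqAle mx andbT; apply: contraNneq rB => <-.
  exact: map_f.
exists b => //; have := metric_triangle x c b; have := metric_triangle c (m c) b.
by move: cm cx mb; rewrite /cdisk/= [mdist x c]metric_sym /h; lra.
Qed.

(* The exceptional radii are those at which the truncation of [A] jumps. *)
Lemma fell_trunc : exists2 B : set R, countable B & forall r e, ~ B r -> 0 < e ->
  \forall n \near \oo,
    sval (A_ n) `&` cdisk (p_ n) r `<=` enlarge (sval A `&` cdisk p r) e /\
    sval A `&` cdisk p r `<=` enlarge (sval (A_ n) `&` cdisk (p_ n) r) e.
Proof.
have /choice[B BP] : forall k : nat, exists B : seq R,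
    forall r, r <= k%:R -> r \notin B -> \forall n \near \oo,
    sval A `&` cdisk p r `<=` enlarge (sval (A_ n) `&` cdisk (p_ n) r) k.+1%:R^-1.
  by move=> k; apply: fell_trunc_lower.
exists (\bigcup_k [set` B k]).
  by apply: bigcup_countable => // k _; apply: finite_set_countable.
move=> r e Br e0.
have [k [rk ke]] := nat_large r e0.
have rB : r \notin B k by apply/negP => rBk; apply: Br; exists k.
apply: filterS2 (fell_trunc_upper r e0) (BP k r rk rB) => n H1 H2; split => //.
by apply: subset_trans H2 _; exact: enlargeS.
Qed.

End fell_truncation.
End fell.

(** * Vague convergence *)

Section borel_measures.
Context {R : realType}.

Lemma compact_borel (X : pmetricType R) (K : set X) :
  compact K -> measurable (K : set (borel X)).
Proof. by move=> cK; apply: closed_borel; exact: metric_compact_closed. Qed.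

Lemma continuous_borel (X : pmetricType R) (h : X -> R) :
  continuous h -> measurable_fun [set: borel X] (h : borel X -> R).
Proof.
move=> ch; apply: (@measurability _ _ (borel X) (measurableTypeR R) _ _ (@RGenOInfty.G R)).
  exact: RGenOInfty.measurableE.
move=> _ [_ [x ->] <-]; rewrite setTI; apply: sub_sigma_algebra => /=.
by apply: open_comp => [y _|]; [exact: ch|exact: interval_open].
Qed.

Lemma isoEmb_preimage_compact (X : bcmType R) (Y : metricType R)
    (f : isoEmb X Y) (K : set Y) : compact K -> compact (f @^-1` K).
Proof.
move=> cK; have [r Kr] := compact_bounded_cdisk (f point) cK.
apply: (@bcm_compact _ _ _ point r).
  apply: preimage_closed; last exact: metric_compact_closed.
  by move=> x _; exact: isoEmb_continuous.
by move=> x /Kr; rewrite /cdisk/= isoEmbP.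
Qed.

Lemma image_measure_radon (X : bcmType R) (Y : pmetricType R) (f : isoEmb X Y)
    (mu : {measure set (borel X) -> \bar R}) :
  radon mu -> radon (image_measure f mu).
Proof. by move=> rmu K cK; apply: rmu; exact: isoEmb_preimage_compact. Qed.

(** A continuous function squeezed between the indicators of [S] and of [enlarge S e], for [S]
    compact and non-empty and [e > 0]. *)
Definition tent (X : metricType R) (S : set X) (e : R) (x : X) : R :=
  Num.max 0 (1 - dset S x / e).

Section tent.
Context (X : metricType R) (S : set X) (e : R).
Hypotheses (cS : compact S) (S0 : S !=set0) (e0 : 0 < e).

Lemma tent_ge0 x : 0 <= tent S e x.
Proof. by rewrite le_max lexx. Qed.

Lemma tent_le1 x : tent S e x <= 1.
Proof.
by rewrite ge_max ler01 gerBl; apply: divr_ge0; [exact: dset_ge0|exact: ltW].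
Qed.

Lemma tent_in x : S x -> tent S e x = 1.
Proof.
move=> Sx; rewrite /tent (_ : dset S x = 0).
  by rewrite mul0r subr0; apply/max_idPr.
apply/eqP; rewrite eq_le dset_ge0// andbT.
by have := dset_le x Sx; rewrite mdistxx.
Qed.

Lemma tent_out x : ~ enlarge S e x -> tent S e x = 0.
Proof.
rewrite enlarge_dset//= => /negP; rewrite -ltNge => ex.
by apply/max_idPl; rewrite subr_le0 ler_pdivlMr// mul1r ltW.
Qed.

Lemma tent_continuous : continuous (tent S e).
Proof.
apply: (@lip_continuous _ _ _ e^-1); first by rewrite invr_gt0.
move=> x y; rewrite /tent.
have h : dset S y / e <= e^-1 * mdist x y + dset S x / e.
  rewrite [e^-1 * _]mulrC -mulrDl ler_wpM2r ?invr_ge0 ?(ltW e0)//.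
  by rewrite metric_sym dset_lip.
have h0 : 0 <= e^-1 * mdist x y by rewrite mulr_ge0 ?mdist_ge0// invr_ge0 ltW.
rewrite ge_max addr_ge0 ?le_max ?lexx//=.
have : 1 - dset S y / e <= Num.max 0 (1 - dset S y / e) by rewrite le_max lexx orbT.
by lra.
Qed.

End tent.

Lemma tent_support (X : bcmType R) (S : set X) e : compact S -> S !=set0 ->
  0 < e -> compact (closure [set x | tent S e x != 0]).
Proof.
move=> cS S0 e0; apply: (@subclosed_compact _ _ (enlarge S e)).
- exact: closed_closure.
- exact: bcm_enlarge_compact.
- rewrite [X in _ `<=` X](closure_id _).1; last exact: enlarge_closed.
  by apply: closureS => x /= /eqP b0; apply: contrapT => /(tent_out cS S0 e0).
Qed.

Local Open Scope ereal_scope.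

Lemma tent_integral_ge (X : pmetricType R) (S : set X) (e : R)
    (nu : {measure set (borel X) -> \bar R}) :
  compact S -> S !=set0 -> (0 < e)%R -> nu S <= \int[nu]_x (tent S e x)%:E.
Proof.
move=> cS S0 e0; have mS := compact_borel cS.
rewrite -[Z in nu Z <= _](setIT (S : set (borel X))) -integral_indic//.
apply: ge0_le_integral => //.
- exact/measurable_EFinP/measurable_indic.
- by apply/measurable_EFinP; exact: (continuous_borel (tent_continuous S0 e0)).
- move=> x _; rewrite lee_fin indicE; have [|_] := boolP (_ \in _).
    by rewrite inE => Sx; rewrite tent_in.
  exact: tent_ge0.
Qed.

Lemma tent_integral_le (X : pmetricType R) (S : set X) (e : R)
    (nu : {measure set (borel X) -> \bar R}) :
  compact S -> S !=set0 -> (0 < e)%R ->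
  \int[nu]_x (tent S e x)%:E <= nu (enlarge S e).
Proof.
move=> cS S0 e0; have mS : measurable (enlarge S e : set (borel X)).
  by apply: closed_borel; exact: enlarge_closed.
rewrite -[Z in _ <= nu Z](setIT (enlarge S e : set (borel X))) -integral_indic//.
apply: ge0_le_integral => //.
- by move=> x _; rewrite lee_fin tent_ge0.
- by apply/measurable_EFinP; exact: (continuous_borel (tent_continuous S0 e0)).
- exact/measurable_EFinP/measurable_indic.
- move=> x _; rewrite lee_fin indicE; have [_|/negP] := boolP (_ \in _).
    exact: tent_le1.
  by rewrite inE => Sx; rewrite tent_out.
Qed.

Section vague_compact.
Context (M : bcmType R) (nu_ : {measure set (borel M) -> \bar R}^nat)
  (nu : {measure set (borel M) -> \bar R}).
Hypotheses (nu_nu : vague_cvg nu_ nu) (rnu : radon nu).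

(** The integrals of [tent S e] converge and lie between the measures of [S] and of its enlargement,
    for each measure involved. *)
Lemma vague_compact (S : set M) (e d : R) : compact S -> (0 < e)%R -> (0 < d)%R ->
  \forall n \near \oo, nu_ n S <= nu (enlarge S e) + d%:E /\
                       nu S <= nu_ n (enlarge S e) + d%:E.
Proof.
move=> cS e0 d0; have [->|/set0P S0] := eqVneq S set0.
  by apply: nearW => n; rewrite !measure0; split; rewrite adde_ge0// lee_fin ltW.
have cb := tent_continuous S0 e0.
have := nu_nu cb (tent_support cS S0 e0).
set I := \int[nu]_x _ => cvgI.
have I0 : 0 <= I by apply: integral_ge0 => x _; rewrite lee_fin tent_ge0.
have Ifin : I \is a fin_num.
  rewrite ge0_fin_numE//; apply: le_lt_trans (tent_integral_le nu cS S0 e0) _.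
  by apply: rnu; exact: bcm_enlarge_compact.
have /fine_cvgP[finI] : (\int[nu_ n]_x (tent S e x)%:E) @[n --> \oo] --> (fine I)%:E.
  by rewrite fineK.
move=> /(@cvgrPdist_lt _ R^o) /(_ d d0) Id.
apply: filterS2 finI Id => n /= In; rewrite ltr_norml => /andP[h1 h2].
have JI : \int[nu_ n]_x (tent S e x)%:E <= I + d%:E.
  by rewrite -(fineK In) -(fineK Ifin) -EFinD lee_fin; lra.
have IJ : I <= \int[nu_ n]_x (tent S e x)%:E + d%:E.
  by rewrite -(fineK In) -(fineK Ifin) -EFinD lee_fin; lra.
split.
  apply: le_trans (tent_integral_ge (nu_ n) cS S0 e0) _.
  by apply: le_trans JI _; rewrite leeD2r// tent_integral_le.
apply: le_trans (tent_integral_ge nu cS S0 e0) _.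
by apply: le_trans IJ _; rewrite leeD2r// tent_integral_le.
Qed.

End vague_compact.
End borel_measures.

(** * Layer-cake approximation *)

Section layer_sum.
Context {R : realType}.

(** For [a > 0] and [t >= 0] this is the largest multiple of [a] not exceeding [t], capped at
    [N * a]. *)
Definition layer_sum (a t : R) (N : nat) : R :=
  \sum_(j < N) a * (j.+1%:R * a <= t)%R%:R.

Lemma layer_sum_ge0 a t N : 0 < a -> 0 <= layer_sum a t N.
Proof. by move=> a0; apply: sumr_ge0 => j _; rewrite mulr_ge0// ltW. Qed.

Lemma layer_sum_le a t N : 0 < a -> 0 <= t -> layer_sum a t N <= t.
Proof.
(* The second bound carries the induction: when a new layer counts, the sum is at most [N * a + a],
   which is at most [t]. *)
move=> a0 t0; suff: layer_sum a t N <= t /\ layer_sum a t N <= N%:R * a by case.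
rewrite /layer_sum; elim: N => [|N [IH1 IH2]]; first by rewrite big_ord0 mul0r.
rewrite big_ord_recr/= -natr1 mulrDl mul1r; case: (leP (N%:R * a + a) t) => ht.
  by rewrite mulr1n mulr1; move: ht; lra.
by rewrite mulr0n mulr0 addr0; split => //; rewrite (le_trans IH2)// lerDl ltW.
Qed.

Lemma le_layer_sum a t N : 0 < a -> 0 <= t -> t <= N%:R * a ->
  t <= a + layer_sum a t N.
Proof.
move=> a0 t0; suff: t <= a + layer_sum a t N \/
    (N%:R * a <= t /\ layer_sum a t N = N%:R * a).
  by case=> // -[h1 h2] h3; rewrite h2; lra.
rewrite /layer_sum; elim: N => [|N IH]; first by right; rewrite big_ord0 mul0r.
rewrite big_ord_recr/= -natr1 mulrDl mul1r; case: (leP (N%:R * a + a) t) => ht.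
  by rewrite mulr1n mulr1; case: IH => [|[h1 h2]]; [left; lra|right; rewrite h2].
by left; rewrite mulr0n mulr0 addr0; case: IH => [//|[h1 h2]]; rewrite h2; lra.
Qed.

End layer_sum.

(** * Vague convergence from closeness on enlarged sets *)

Section close_vague.
Context {R : realType} {M : bcmType R}.

(** The one-sided form suffices and is trivial for [x] outside [S], so uniformity is needed only
    over the compact set [S]. *)
Lemma compact_support_unif (h : M -> R) (S : set M) (a : R) :
  continuous h -> (forall x, 0 <= h x) -> compact S ->
  (forall x, ~ S x -> h x = 0) -> 0 < a ->
  exists2 e, 0 < e & forall x y, mdist x y <= e -> h x <= h y + a.
Proof.
move=> ch h0 /compact_near_coveringP cS hS a0.
pose good e x := forall y, mdist x y <= e -> h x <= h y + a.
have H : \forall e \near 0^'+, S `<=` good e.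
  apply: cS => x Sx.
  have a20 : 0 < a / 2 by lra.
  have /(@cvgrPdist_lt _ R^o) /(_ _ a20) /nbhs_mdist_sub[r r0 rh] := ch x.
  exists ([set y | mdist x y < r / 2], [set e | e < r / 2]) => /=.
    by split; [apply: near_mdist_lt; lra|apply: nbhs_right_lt; lra].
  move=> [y e] [/= xy er] z yz.
  have xz : mdist x z < r by have := metric_triangle x y z; lra.
  have xy' : mdist x y < r by have := mdist_ge0 x y; lra.
  move: (rh z xz) (rh y xy'); rewrite /= !ltr_norml => /andP[_ h1] /andP[h2 _].
  by lra.
have [e [e0 He]] : exists e, 0 < e /\ S `<=` good e.
  near (0 : R)^'+ => e; exists e; split; near: e => //.
  exact: nbhs_right_gt.
exists e => // x y xy; have [Sx|nSx] := pselect (S x); first exact: He xy.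
by rewrite hS// addr_ge0// ltW.
Unshelve. all: by end_near. Qed.

Local Open Scope ereal_scope.

Section layers.
Variables (h : M -> R) (S : set M) (a : R) (N : nat).
Hypotheses (ch : continuous h) (h0 : forall x, (0 <= h x)%R) (cS : compact S)
  (hS : forall x, ~ S x -> h x = 0%R) (a0 : (0 < a)%R)
  (hN : forall x, (h x <= N%:R * a)%R).

Let layer (j : nat) : set M := [set x | (j.+1%:R * a <= h x)%R].

Let layer_closed j : closed (layer j).
Proof.
rewrite (_ : layer j = h @^-1` [set t | j.+1%:R * a <= t]%R)//.
by apply: preimage_closed => [x _|]; [exact: ch|exact: closed_ge].
Qed.

Let layer_sub j : layer j `<=` S.
Proof.
move=> x; apply: contraPP => /hS; rewrite /layer/= => ->.
by apply/negP; rewrite -ltNge mulr_gt0.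
Qed.

Let layer_compact j : compact (layer j).
Proof.
by apply: (@subclosed_compact _ _ S).
Qed.

Let mlayer j : measurable (layer j : set (borel M)).
Proof. exact: compact_borel. Qed.

Let mS : measurable (S : set (borel M)). Proof. exact: compact_borel. Qed.

Let mh : measurable_fun [set: borel M] (EFin \o h).
Proof. by apply/measurable_EFinP; exact: continuous_borel. Qed.

Let layerE (nu : {measure set (borel M) -> \bar R}) :
  \int[nu]_x (\sum_(j < N) a%:E * (\1_(layer j : set (borel M)) x)%:E) =
  \sum_(j < N) a%:E * nu (layer j).
Proof.
rewrite ge0_integral_sum//.
- apply: eq_bigr => j _; rewrite ge0_integralZl//.
  + by rewrite integral_indic// setIT.
  + exact/measurable_EFinP/measurable_indic.
  + by rewrite lee_fin ltW.
- move=> j; apply: measurable_funeM.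
  exact/measurable_EFinP/measurable_indic.
- by move=> j x _; rewrite mule_ge0// lee_fin// ltW.
Qed.

Let layer_sumE x : \sum_(j < N) a%:E * (\1_(layer j : set (borel M)) x)%:E =
  (layer_sum a (h x) N)%:E.
Proof.
rewrite /layer_sum -sumEFin; apply: eq_bigr => j _; rewrite -EFinM indicE.
suff -> : (x \in (layer j : set (borel M))) = (j.+1%:R * a <= h x)%R by [].
by apply/idP/idP; rewrite inE.
Qed.

Lemma layers_le_integral (nu : {measure set (borel M) -> \bar R}) :
  \sum_(j < N) a%:E * nu (layer j) <= \int[nu]_x (h x)%:E.
Proof.
rewrite -layerE; under eq_integral do rewrite layer_sumE.
apply: ge0_le_integral => //.
- by move=> x _; rewrite lee_fin layer_sum_ge0.
- under eq_fun do rewrite -layer_sumE.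
  apply: emeasurable_sum => j; apply: measurable_funeM.
  exact/measurable_EFinP/measurable_indic.
- by move=> x _; rewrite lee_fin layer_sum_le.
Qed.

Lemma integral_le_layers (nu : {measure set (borel M) -> \bar R}) :
  \int[nu]_x (h x)%:E <= a%:E * nu S + \sum_(j < N) a%:E * nu (layer j).
Proof.
have m1 : measurable_fun [set: borel M] (fun x => a%:E * (\1_(S : set (borel M)) x)%:E).
  by apply: measurable_funeM; exact/measurable_EFinP/measurable_indic.
have m2 : measurable_fun [set: borel M]
    (fun x => \sum_(j < N) a%:E * (\1_(layer j : set (borel M)) x)%:E).
  apply: emeasurable_sum => j; apply: measurable_funeM.
  exact/measurable_EFinP/measurable_indic.
have -> : a%:E * nu S = \int[nu]_x (a%:E * (\1_(S : set (borel M)) x)%:E).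
  rewrite ge0_integralZl//.
  + by rewrite integral_indic// setIT.
  + exact/measurable_EFinP/measurable_indic.
  + by rewrite lee_fin ltW.
rewrite -layerE -ge0_integralD//; last 2 first.
- by move=> x _; rewrite mule_ge0// lee_fin// ltW.
- by move=> x _; rewrite layer_sumE lee_fin layer_sum_ge0.
apply: ge0_le_integral => //.
- by move=> x _; rewrite lee_fin.
- exact: emeasurable_funD.
- move=> x _; rewrite layer_sumE -EFinM -EFinD lee_fin indicE.
  have [xS|/negP] := boolP (_ \in _); first by rewrite mulr1 le_layer_sum.
  by rewrite inE => /hS ->; rewrite mulr0 add0r layer_sum_ge0.
Qed.

(* The layer [h >= (j + 1) a] enlarged by [e] is contained in [h >= j a]. *)
Lemma integral_close (nu nu' : {measure set (borel M) -> \bar R}) (e : R) :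
  (0 <= e)%R -> (forall x y, mdist x y <= e -> h x <= h y + a)%R ->
  (forall A, closed A -> A `<=` S -> nu A <= nu' (enlarge A e) + e%:E) ->
  \int[nu]_x (h x)%:E <=
  \int[nu']_x (h x)%:E + a%:E * (nu S + nu' (enlarge S e)) + (N%:R * a * e)%:E.
Proof.
move=> e_ge0 he nue; apply: le_trans (integral_le_layers nu) _.
have mSe : measurable (enlarge S e : set (borel M)).
  by apply: closed_borel; exact: enlarge_closed.
(* The lowest layer has no layer beneath it to land in; the enlargement of the support takes that
   place. *)
have step (j : nat) : nu (layer j) <=
    (if j is i.+1 then nu' (layer i) else nu' (enlarge S e)) + e%:E.
  apply: le_trans (nue _ (@layer_closed j) (@layer_sub j)) _.
  rewrite leeD2r//; case: j => [|j].
    apply: le_measure; rewrite ?inE//.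
      by apply: closed_borel; exact: enlarge_closed.
    exact: enlargeS.
  apply: le_measure; rewrite ?inE//.
    by apply: closed_borel; exact: enlarge_closed.
  move=> x [y] + xy; rewrite /layer/=; have := he y x; rewrite metric_sym => /(_ xy).
  by rewrite -natr1 mulrDl mul1r; lra.
have -> : (N%:R * a * e)%:E = \sum_(j < N) (a * e)%:E.
  by rewrite sumEFin sumr_const card_ord -mulrA mulr_natl.
pose t j := if j is i.+1 then nu' (layer i) else nu' (enlarge S e).
have sum_step : \sum_(j < N) a%:E * nu (layer j) <=
    \sum_(j < N) a%:E * t j + \sum_(j < N) (a * e)%:E.
  rewrite -big_split/=; apply: lee_sum => j _.
  rewrite EFinM -ge0_muleDr//; last by rewrite /t; case: (nat_of_ord j).
  by rewrite lee_pmul2l// ?lte_fin//; exact: step.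
have shift : \sum_(j < N) a%:E * t j <=
    a%:E * nu' (enlarge S e) + \sum_(j < N) a%:E * nu' (layer j).
  have a_ge0 x : 0 <= x -> 0 <= a%:E * x by move=> ?; rewrite mule_ge0// lee_fin ltW.
  case: (N) => [|n].
    by rewrite !big_ord0 adde0 a_ge0.
  rewrite big_ord_recl/= leeD2l// big_ord_recr/= leeDl// a_ge0//.
apply: le_trans (leeD2l _ sum_step) _.
rewrite addeA leeD2r// ge0_muleDr// addeCA addeA [leRHS]addeC [leRHS]addeA.
apply: le_trans (leeD2l _ shift) _; rewrite addeCA addeA leeD2l//.
exact: layers_le_integral.
Qed.

End layers.

Context (nu_ : {measure set (borel M) -> \bar R}^nat)
  (nu : {measure set (borel M) -> \bar R}) (p : M).
Hypothesis rnu : radon nu.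
Hypothesis close : forall r e, (0 < e)%R -> \forall n \near \oo,
  forall A, closed A -> A `<=` cdisk p r ->
    nu_ n A <= nu (enlarge A e) + e%:E /\ nu A <= nu_ n (enlarge A e) + e%:E.

Let ge0_close_cvg (h : M -> R) (S : set M) : continuous h ->
  (forall x, (0 <= h x)%R) -> compact S -> (forall x, ~ S x -> h x = 0%R) ->
  (\int[nu]_x (h x)%:E) \is a fin_num /\
  \int[nu_ n]_x (h x)%:E @[n --> \oo] --> \int[nu]_x (h x)%:E.
Proof.
move=> ch h0 cS hS.
have [r Sr] := compact_bounded_cdisk p cS.
have [b hb] : exists b, forall x, (h x <= b)%R.
  have [SE|/set0P S0] := eqVneq S set0; first by exists 0%R => x; rewrite hS// SE.
  have [c Sc cmax] := @compact_EVT_max _ _ h S S0 cS (continuous_subspaceT ch).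
  exists (h c) => x; have [Sx|/hS ->//] := pselect (S x).
  by apply: cmax; rewrite inE.
(* Radius 2 leaves room for two successive enlargements by [e <= 1]. *)
pose S2 := enlarge S 2.
have cS2 : compact S2 by exact: bcm_enlarge_compact.
pose C := fine (nu S2).
have C0 : (0 <= C)%R by rewrite fine_ge0.
have nuS2 : nu S2 = C%:E.
  by rewrite fineK// ge0_fin_numE//; exact: rnu.
have mE (K : set M) e : compact K -> measurable (enlarge K e : set (borel M)).
  by move=> cK; apply: closed_borel; exact: enlarge_closed.
have nuSe e : (0 <= e <= 2)%R -> nu (enlarge S e) <= C%:E.
  move=> /andP[e0 e2]; rewrite -nuS2; apply: le_measure; rewrite ?inE//.
  - exact: mE.
  - exact: mE.
  - exact: enlargeS.
have mS : measurable (S : set (borel M)) by exact: compact_borel.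
have nuS : nu S <= C%:E.
  apply: le_trans (nuSe 0%R _); last by rewrite lexx ler0n.
  apply: le_measure; rewrite ?inE//; first exact: mE.
  exact: subset_enlarge.
have finI : (\int[nu]_x (h x)%:E) \is a fin_num.
  rewrite ge0_fin_numE; last by apply: integral_ge0 => x _; rewrite lee_fin.
  apply: (@le_lt_trans _ _ (\int[nu]_(x in S) (cst b%:E x))).
    rewrite [leRHS]integral_mkcond; apply: ge0_le_integral => //.
    - by move=> x _; rewrite lee_fin.
    - by apply/measurable_EFinP; exact: continuous_borel.
    - by apply/(measurable_restrictT _ mS); exact: measurable_cst.
    - move=> x _; rewrite patchE; case: ifPn => [|/negP]; rewrite inE => Sx.
        by rewrite lee_fin.
      by rewrite hS.
  rewrite integral_cst//; apply: lte_mul_pinfty => //.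
    by rewrite lee_fin (le_trans (h0 p)).
  exact: rnu.
split => //.
have key (d : R) : (0 < d)%R -> \forall n \near \oo,
    \int[nu_ n]_x (h x)%:E <= \int[nu]_x (h x)%:E + d%:E /\
    \int[nu]_x (h x)%:E <= \int[nu_ n]_x (h x)%:E + d%:E.
  move=> d0.
  (* The two masses in the error term of [integral_close] are at most [C + 1] and [C], so the layer
     height [a] costs at most [d / 2]; the other half pays for [N * a * e] below. *)
  pose a := (d / 2 / (2 * C + 1))%R.
  have C1 : (0 < 2 * C + 1)%R by lra.
  have a0 : (0 < a)%R by rewrite !divr_gt0.
  have [e1 e10 he1] := compact_support_unif ch h0 cS hS a0.
  pose N := (Num.truncn (b / a)).+1.
  have hN x : (h x <= N%:R * a)%R.
    rewrite (le_trans (hb x))// -ler_pdivrMr// ltW//.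
    by rewrite truncnS_gt.
  have Na : (0 < N%:R * a)%R by rewrite mulr_gt0// ltr0n.
  pose e := (Num.min (Num.min e1 1) (d / 2 / (N%:R * a)))%R.
  have e0 : (0 < e)%R by rewrite !lt_min e10 ltr01 !divr_gt0.
  have [ee1 eE1] : (e <= e1 /\ e <= 1)%R.
    by split; rewrite !ge_min lexx ?orbT.
  have Nae : (N%:R * a * e <= d / 2)%R.
    by rewrite mulrC -ler_pdivlMr// ge_min lexx orbT.
  have he x y : (mdist x y <= e -> h x <= h y + a)%R.
    by move=> xy; apply: he1; exact: le_trans ee1.
  have err (I x y : \bar R) : x <= C%:E + 1 -> y <= C%:E -> 0 <= x -> 0 <= y ->
      I + a%:E * (x + y) + (N%:R * a * e)%:E <= I + d%:E.
    move=> xC yC x0 y0; rewrite -addeA leeD2l//.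
    have -> : d%:E = (a * (2 * C + 1))%:E + (d / 2)%:E.
      by rewrite -EFinD; congr _%:E; rewrite /a divfK ?gt_eqF//; lra.
    apply: leeD; last by rewrite lee_fin.
    rewrite [leRHS]EFinM lee_pmul2l ?lte_fin//.
    apply: le_trans (leeD xC yC) _; rewrite -!EFinD lee_fin; lra.
  apply: filterS (close (r + 1) e0) => n Hn.
  have SeR : enlarge S e `<=` cdisk p (r + 1).
    apply: subset_trans (enlargeS Sr (lexx e)) _.
    by apply: subset_trans (@enlarge_cdisk _ _ p r e) _; apply: cdiskS; rewrite mdistxx; lra.
  have SR : S `<=` cdisk p (r + 1).
    by apply: subset_trans Sr _; apply: cdiskS; rewrite mdistxx; lra.
  have cSe : compact (enlarge S e) by exact: bcm_enlarge_compact.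
  have nS : nu_ n S <= C%:E + 1.
    have [H _] := Hn S (metric_compact_closed cS) SR.
    by apply: le_trans H _; apply: leeD; [apply: nuSe; lra|rewrite lee_fin].
  have nSe : nu_ n (enlarge S e) <= C%:E + 1.
    have [H _] := Hn _ (enlarge_closed (e := e) cS) SeR.
    apply: le_trans H _; apply: leeD; last by rewrite lee_fin.
    apply: le_trans (nuSe (e + e)%R _); last lra.
    apply: le_measure; rewrite ?inE//; [exact: mE|exact: mE|exact: enlarge_enlarge].
  split.
    apply: le_trans (integral_close ch h0 cS hS a0 hN (ltW e0) he _) (err _ _ _ nS _ _ _) => //.
    - by move=> A cA AS; have [] := Hn A cA (subset_trans AS SR).
    - by apply: nuSe; lra.
  apply: le_trans (integral_close (nu' := nu_ n) ch h0 cS hS a0 hN (ltW e0) he _) _.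
    by move=> A cA AS; have [] := Hn A cA (subset_trans AS SR).
  by rewrite [nu S + _]addeC; exact: err.
rewrite -(fineK finI); apply/fine_cvgP; split.
  apply: filterS (key 1%R ltr01) => n [+ _].
  rewrite ge0_fin_numE; last by apply: integral_ge0 => x _; rewrite lee_fin.
  by move=> /le_lt_trans; apply; rewrite -(fineK finI) -EFinD ltry.
apply/(@cvgrPdist_le _ R^o) => d d0; apply: filterS (key d d0) => n [/= H1 H2].
have fn : (\int[nu_ n]_x (h x)%:E) \is a fin_num.
  rewrite ge0_fin_numE; last by apply: integral_ge0 => x _; rewrite lee_fin.
  by apply: (le_lt_trans H1); rewrite -(fineK finI) -EFinD ltry.
move: H1 H2; rewrite -(fineK finI) -(fineK fn) -!EFinD !lee_fin !fineK// => H1 H2.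
by rewrite ler_norml; apply/andP; split; lra.
Qed.

(** Positive and negative parts of [h] are treated separately; their limit integrals are finite, so
    the difference is well defined. *)
Lemma close_vague_cvg : vague_cvg nu_ nu.
Proof.
move=> h ch cS.
pose S := closure [set x | h x != 0%R].
have hS x : ~ S x -> h x = 0%R.
  by apply: contra_notP => /eqP hx; exact: subset_closure.
have cp : continuous (fun x => Num.max (h x) 0%R).
  move=> x; apply: (@continuous_max _ _ h (cst 0%R)).
    exact: ch.
  exact: (@cst_continuous M R 0%R).
have cn : continuous (fun x => Num.max (- h x)%R 0%R).
  move=> x; apply: (@continuous_max _ _ (fun x => - h x)%R (cst 0%R)).
    by apply: (@continuousN R R^o M h x); exact: ch.
  exact: (@cst_continuous M R 0%R).
have [|x nSx|fp cvp] := ge0_close_cvg cp _ cS.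
- by move=> x; rewrite le_max lexx orbT.
- by rewrite hS// maxxx.
have [|x nSx|fn cvn] := ge0_close_cvg cn _ cS.
- by move=> x; rewrite le_max lexx orbT.
- by rewrite hS// oppr0 maxxx.
have E (m : {measure set (borel M) -> \bar R}) : \int[m]_x (h x)%:E =
    \int[m]_x (Num.max (h x) 0%R)%:E - \int[m]_x (Num.max (- h x)%R 0%R)%:E.
  rewrite integralE; congr (_ - _); apply: eq_integral => x _.
    by rewrite funeposE EFin_max.
  by rewrite funenegE EFin_max.
rewrite E; under eq_cvg do rewrite E.
by apply: cvgeB => //; rewrite fin_num_adde_defr// fin_numN.
Qed.

End close_vague.

(** * Spheres charged by a Radon measure *)

Section spheres.
Context {R : realType} {M : bcmType R} (nu : {measure set (borel M) -> \bar R})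
  (p : M).
Hypothesis rnu : radon nu.
Local Open Scope ereal_scope.

Definition sphere (r : R) : set M := [set x | mdist p x = r].

Lemma sphere_closed r : closed (sphere r).
Proof.
rewrite (_ : sphere r = mdist p @^-1` [set r])//.
by apply: preimage_closed => [x _|]; [exact: continuous_mdist|exact: closed_eq].
Qed.

Let msphere r : measurable (sphere r : set (borel M)).
Proof. by apply: closed_borel; exact: sphere_closed. Qed.

(** Spheres of different radii are disjoint, so infinitely many of mass above [1 / (n + 1)] would
    exceed the finite mass of the ball of radius [k]. *)
Let finite_spheres (k n : nat) :
  finite_set [set r | (r <= k%:R)%R /\ (n.+1%:R^-1)%:E < nu (sphere r)].
Proof.
apply: contrapT => /infiniteP/pcard_leP/injfunPex[/= q q_fun q_inj].
have cD : compact (cdisk p k%:R) by exact: cdisk_compact.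
have Dfin : nu (cdisk p k%:R) \is a fin_num.
  by rewrite ge0_fin_numE//; exact: rnu.
pose N := (Num.truncn (fine (nu (cdisk p k%:R)) * n.+1%:R)).+1.
have NC : (fine (nu (cdisk p k%:R)) < N%:R * n.+1%:R^-1)%R.
  by rewrite ltr_pdivlMr// /N truncnS_gt.
have : \sum_(0 <= i < N) nu (sphere (q i)) <= nu (cdisk p k%:R).
  rewrite big_mkord.
  rewrite -(@measure_semi_additive_ord_I _ _ _ nu (fun i => sphere (q i)))//;
    last 2 first.
  - apply/trivIsetP => i j _ _ ij; rewrite -subset0 => x [].
    rewrite /sphere/= => -> /q_inj qij; move/eqP: ij; apply.
    by apply: qij; rewrite inE.
  - exact: bigsetU_measurable.
  apply: le_measure; rewrite ?inE//.
  - exact: bigsetU_measurable.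
  - exact: compact_borel.
  - rewrite -(bigcup_mkord N (fun i => sphere (q i))) => x [i _]; rewrite /sphere /cdisk/= => ->.
    by have [] := q_fun i I.
apply/negP; rewrite -ltNge -(fineK Dfin).
apply: (@lt_le_trans _ _ (\sum_(0 <= i < N) (n.+1%:R^-1)%:E)).
  by rewrite sumEFin lte_fin sumr_const_nat subn0 -[X in (_ < X)%R]mulr_natl.
by apply: lee_sum => i _; apply: ltW; have [] := q_fun i I.
Qed.

Lemma countable_spheres : countable [set r | nu (sphere r) != 0].
Proof.
apply: (@sub_countable _ _ _ (\bigcup_(kn in [set: nat * nat])
    [set r | (r <= kn.1%:R)%R /\ (kn.2.+1%:R^-1)%:E < nu (sphere r)])).
  apply: subset_card_le => r /= r0.
  have {r0} : 0 < nu (sphere r) by rewrite lt0e r0 measure_ge0.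
  have cS : compact (sphere r).
    apply: (@bcm_compact _ _ _ p r); first exact: sphere_closed.
    by move=> x; rewrite /sphere /cdisk/= => ->.
  have Sfin : nu (sphere r) \is a fin_num by rewrite ge0_fin_numE//; exact: rnu.
  rewrite -(fineK Sfin) lte_fin => r0.
  have [n] := ltr_add_invr r0; rewrite add0r => nr.
  exists ((Num.truncn `|r|).+1, n) => //=; split.
    by rewrite (le_trans (ler_norm _))// ltW// truncnS_gt.
  by rewrite -(fineK Sfin) lte_fin.
by apply: bigcup_countable => // -[k n] _; apply: finite_set_countable.
Qed.

Lemma shell_borel r d :
  measurable ([set x | r - d <= mdist p x <= r + d]%R : set (borel M)).
Proof.
apply: closed_borel.
rewrite (_ : mkset _ = mdist p @^-1` `[r - d, r + d]%classic)%R.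
  by apply: preimage_closed => [x _|]; [exact: continuous_mdist|exact: itv_closed].
by apply/seteqP; split => x /=; rewrite in_itv.
Qed.

(** Continuity from above: the shells of half-width [1 / (n + 1)] decrease to the sphere, and the
    first lies in a ball of finite measure. *)
Lemma sphere_shell r e : nu (sphere r) = 0 -> (0 < e)%R ->
  exists2 d, (0 < d)%R &
    nu [set x | r - d <= mdist p x <= r + d]%R <= e%:E.
Proof.
move=> r0 e0.
pose F (n : nat) : set M :=
  [set x | r - n.+1%:R^-1 <= mdist p x <= r + n.+1%:R^-1]%R.
have FE : \bigcap_n F n = sphere r.
  apply/seteqP; split => [x Fx|x xr n _].
    apply/eqP; rewrite eq_le; apply/andP; split; apply/ler_addgt0Pr => d d0.
      have [n _ nd] := near_infty_natSinv_lt (PosNum d0).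
      have /andP[_ H] := Fx n I; apply: le_trans H _.
      by rewrite lerD2l ltW//; exact: nd (leqnn n).
    have [n _ nd] := near_infty_natSinv_lt (PosNum d0).
    have /andP[H _] := Fx n I.
    have nd' : (n.+1%:R^-1 < d)%R := nd n (leqnn n).
    by rewrite -lerBlDr (le_trans _ H)// lerD2l lerN2 ltW.
  rewrite /F/= (xr : mdist p x = r) gerBl lerDl invr_ge0 ler0n//.
have : nu (F n) @[n --> \oo] --> nu (\bigcap_n F n).
  apply: nonincreasing_cvg_mu.
  - apply: le_lt_trans (rnu (cdisk_compact p (r + 1))).
    apply: le_measure; rewrite ?inE; [exact: shell_borel|exact: cdisk_borel|].
    by move=> x /andP[_]; rewrite /cdisk/= invr1.
  - by move=> n; exact: shell_borel.
  - rewrite FE; exact: msphere.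
  - move=> m n mn; apply/subsetPset => x /andP[h1 h2].
    have : (n.+1%:R^-1 <= m.+1%:R^-1 :> R)%R by rewrite lef_pV2 ?posrE// ler_nat.
    move=> h3; apply/andP; split.
      by rewrite (le_trans _ h1)// lerD2l lerN2.
    by rewrite (le_trans h2)// lerD2l.
rewrite FE r0 => /fine_cvgP[F_fin] /(@cvgrPdist_lt _ R^o) /(_ e e0) Fe.
have [n [/= fn en]] := filter_ex (filterI F_fin Fe).
exists (n.+1%:R^-1)%R; first by rewrite invr_gt0.
rewrite -/(F n) -(fineK fn) lee_fin.
by move: en; rewrite /= sub0r normrN ger0_norm ?fine_ge0// => /ltW.
Qed.

End spheres.

Section vague_truncation.
Context {R : realType} {M : bcmType R} (nu_ : {measure set (borel M) -> \bar R}^nat)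
  (nu : {measure set (borel M) -> \bar R}) (p_ : nat -> M) (p : M).
Hypotheses (nu_nu : vague_cvg nu_ nu) (rnu : radon nu)
  (p_p : p_ n @[n --> \oo] --> p).
Local Open Scope ereal_scope.

(* Only finitely many sets [C] are involved: unions of balls of a finite net
   that meet [A]; hence the uniformity in [A]. *)
Lemma vague_trunc (r e : R) : nu (sphere p r) = 0 -> (0 < e)%R ->
  \forall n \near \oo, forall A : set M, exists C C' : set M,
    [/\ closed C /\ closed C', A `&` cdisk p (r + 1) `<=` C, C' `<=` enlarge A e,
        nu_ n (C `&` cdisk (p_ n) r) <= nu (C' `&` cdisk p r) + e%:E &
        nu (C `&` cdisk p r) <= nu_ n (C' `&` cdisk (p_ n) r) + e%:E].
Proof.
move=> r0 e0.
have e20 : (0 < e / 2)%R by lra.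
have [d d0 shd] := sphere_shell rnu r0 e20.
(* [3 * h <= e] covers the three legs from a point of [C'] to a point of [A]; [3 * h <= d] keeps all
   boundary errors in the shell of small mass. *)
pose h := (Num.min (d / 3) (e / 3))%R.
have h0 : (0 < h)%R by rewrite lt_min; lra.
have hd : (3 * h <= d)%R.
  have : (h <= d / 3)%R by rewrite ge_min lexx. lra.
have he : (3 * h <= e)%R.
  have : (h <= e / 3)%R by rewrite ge_min lexx orbT. lra.
have {}shd : nu [set x | r - 3 * h <= mdist p x <= r + 3 * h]%R <= (e / 2)%:E.
  apply: le_trans shd; apply: le_measure; rewrite ?inE; do ?exact: shell_borel.
  by move=> x /= /andP[h1 h2]; apply/andP; split; lra.
have U2 (A B : set M) : measurable (A : set (borel M)) ->
    measurable (B : set (borel M)) -> nu (A `|` B) <= nu A + nu B.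
  by move=> mA mB; exact: measureU2.
have [s [_ sn]] := compact_finite_net (cdisk_compact p (r + 1)) h0.
(* Subsets of the net are encoded by Boolean masks, a finite type, so that one eventual bound holds
   for all of them. *)
pose C (m : (size s).-tuple bool) : set M := enlarge [set` mask m s] h.
have cfin m : compact [set` mask m s] by apply: finite_compact; exact: finite_seq.
have cC m : compact (C m) by apply: bcm_enlarge_compact.
have cC' m : closed (enlarge (C m) h) by apply: enlarge_closed.
have cS m t : compact (C m `&` cdisk p t).
  by apply: compact_closedI => //; exact: cdisk_closed.
have mC m t q : measurable (C m `&` cdisk q t : set (borel M)).
  by apply: measurableI; [exact: compact_borel|exact: cdisk_borel].
have mC' m t q : measurable (enlarge (C m) h `&` cdisk q t : set (borel M)).
  by apply: measurableI; [exact: closed_borel|exact: cdisk_borel].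
have mE m t : measurable (enlarge (C m `&` cdisk p t) h : set (borel M)).
  by apply: closed_borel; apply: enlarge_closed.
(* These truncations are centred at the fixed [p]: radius [r + h] covers [cdisk (p_ n) r], while
   radius [r - 3 * h] still fits in it after enlarging by [h]. The discrepancy is charged to the
   shell. *)
have H : \forall n \near \oo, forall m : (size s).-tuple bool,
    nu_ n (C m `&` cdisk p (r + h)) <=
      nu (enlarge (C m `&` cdisk p (r + h)) h) + (e / 2)%:E /\
    nu (C m `&` cdisk p (r - 3 * h)) <=
      nu_ n (enlarge (C m `&` cdisk p (r - 3 * h)) h) + (e / 2)%:E.
  apply: filter_forall => m.
  apply: filterS2 (vague_compact nu_nu rnu (cS m (r + h)%R) h0 e20)
    (vague_compact nu_nu rnu (cS m (r - 3 * h)%R) h0 e20).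
  by move=> n [? _] [_ ?].
have pn : \forall n \near \oo, (mdist p (p_ n) < h)%R.
  by apply: metricType_numDomainType.cvgr_dist_lt.
apply: filterS2 H pn => n Hn pnh A.
pose m : (size s).-tuple bool :=
  map_tuple (fun c => `[< cdisk c h `&` A !=set0 >]) (in_tuple s).
have maskE : mask m s = [seq c <- s | `[< cdisk c h `&` A !=set0 >]].
  by rewrite filter_mask.
have [H1 H2] := Hn m.
exists (C m), (enlarge (C m) h); split.
- by split => //; exact: metric_compact_closed.
- move=> x [Ax xr]; have [c cs cx] := sn x xr.
  exists c; last by rewrite metric_sym ltW.
  rewrite /= maskE mem_filter cs andbT; apply/asboolP.
  by exists x; split => //; exact: ltW.
- move=> x [y [c + yc] xy]; rewrite /= maskE mem_filter => /andP[/asboolP[z [cz Az]] _].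
  exists z => //; have := metric_triangle x y z; have := metric_triangle y c z.
  by move: cz; rewrite /cdisk/=; lra.
- apply: (@le_trans _ _ (nu_ n (C m `&` cdisk p (r + h)))).
    apply: le_measure; rewrite ?inE; do ?exact: mC.
    by apply: setIS; apply: cdiskS; lra.
  apply: le_trans H1 _; rewrite {2}(splitr e) EFinD addeA leeD2r//.
  apply: (@le_trans _ _ (nu ((enlarge (C m) h `&` cdisk p r) `|`
      [set x | r - 3 * h <= mdist p x <= r + 3 * h]%R))).
    apply: le_measure; rewrite ?inE.
    + exact: mE.
    + by apply: measurableU => //; exact: shell_borel.
    + move=> x [y [Cy yr] xy]; have [xr|rx] := leP (mdist p x) r.
        by left; split => //; exists y.
      right => /=; apply/andP; split; first by lra.
      by have := metric_triangle p y x; move: yr; rewrite /cdisk/= [mdist y x]metric_sym; lra.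
  apply: le_trans (U2 _ _ _ _) _ => //; first exact: shell_borel.
  by rewrite leeD2l.
- apply: (@le_trans _ _ (nu ((C m `&` cdisk p (r - 3 * h)) `|`
      [set x | r - 3 * h <= mdist p x <= r + 3 * h]%R))).
    apply: le_measure; rewrite ?inE; first exact: mC.
      by apply: measurableU => //; exact: shell_borel.
    move=> x [Cx xr]; have [xr'|rx] := leP (mdist p x) (r - 3 * h)%R.
      by left.
    by right => /=; apply/andP; split; [exact: ltW|move: xr; rewrite /cdisk/=; lra].
  apply: le_trans (U2 _ _ _ _) _ => //; first exact: shell_borel.
  rewrite (splitr e) EFinD addeA; apply: leeD => //.
  apply: le_trans H2 _; rewrite leeD2r//.
  apply: le_measure; rewrite ?inE; [exact: mE|exact: mC'|].
  move=> x [y [Cy yr] xy]; split; first by exists y.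
  have := metric_triangle (p_ n) p x; have := metric_triangle p y x.
  by move: yr; rewrite /cdisk/= [mdist y x]metric_sym [mdist (p_ n) p]metric_sym; lra.
Qed.

End vague_truncation.

(** * From a common space to the metrics *)

Section distances.
Context {R : realType}.
Local Open Scope ereal_scope.

Lemma ereal_cvg0 (u : nat -> \bar R) : (forall n, 0 <= u n) ->
  (forall e, (0 < e)%R -> \forall n \near \oo, u n <= e%:E) ->
  u n @[n --> \oo] --> 0.
Proof.
move=> u0 ue; apply/fine_cvgP; split.
  apply: filterS (ue 1%R ltr01) => n un.
  by rewrite ge0_fin_numE// (le_lt_trans un)// ltry.
apply/(@cvgrPdist_le _ R^o) => e e0; apply: filterS (ue e e0) => n un /=.
have fn : u n \is a fin_num by rewrite ge0_fin_numE// (le_lt_trans un)// ltry.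
by rewrite sub0r normrN ger0_norm ?fine_ge0// -lee_fin fineK.
Qed.

Lemma cvg0_lt (u : nat -> \bar R) (e : R) : u n @[n --> \oo] --> 0 ->
  (0 < e)%R -> \forall n \near \oo, u n < e%:E.
Proof.
move=> /fine_cvgP[fu] /(@cvgrPdist_lt _ R^o) ue e0.
apply: filterS2 fu (ue e e0) => n fn /=.
rewrite sub0r normrN -(fineK fn) lte_fin /= => h.
exact: le_lt_trans (ler_norm _) h.
Qed.

Lemma dH_ge0 (X : metricType R) (A B : set X) : 0 <= dH A B.
Proof. by apply: le_ereal_inf_tmp => _ [e [e0 _ _] <-]; rewrite lee_fin. Qed.

Lemma dH_le (X : metricType R) (A B : set X) e : (0 <= e)%R ->
  A `<=` enlarge B e -> B `<=` enlarge A e -> dH A B <= e%:E.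
Proof. by move=> e0 AB BA; apply: ereal_inf_lbound; exists e. Qed.

Lemma dH_lt (X : metricType R) (A B : set X) e : dH A B < e%:E ->
  A `<=` enlarge B e /\ B `<=` enlarge A e.
Proof.
move=> /ereal_inf_lt[_ [d [d0 AB BA] <-]]; rewrite lte_fin => /ltW de.
by split; [apply: subset_trans AB _|apply: subset_trans BA _]; exact: enlargeS.
Qed.

Lemma dP_ge0 (X : pmetricType R) (mu nu : {measure set (borel X) -> \bar R}) :
  0 <= dP mu nu.
Proof. by apply: le_ereal_inf_tmp => _ [e [e0 _] <-]; rewrite lee_fin ltW. Qed.

(** A Borel set [B] inside the enlargement bounds its outer measure from below, so the enlargement
    itself need not be measured. *)
Lemma dP_le (X : pmetricType R) (mu nu : {measure set (borel X) -> \bar R}) e :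
  (0 < e)%R ->
  (forall A : set (borel X), measurable A ->
    (exists B : set (borel X), [/\ measurable B, B `<=` enlarge (A : set X) e &
      mu A <= nu B + e%:E]) /\
    (exists B : set (borel X), [/\ measurable B, B `<=` enlarge (A : set X) e &
      nu A <= mu B + e%:E])) ->
  dP mu nu <= e%:E.
Proof.
move=> e0 H; apply: ereal_inf_lbound; exists e => //; split => // A mA.
have [[B [mB BA H1]] [B' [mB' BA' H2]]] := H A mA.
split.
  by apply: le_trans H1 _; rewrite leeD2r// -measurable_mu_extE//; exact: le_mu_ext.
by apply: le_trans H2 _; rewrite leeD2r// -measurable_mu_extE//; exact: le_mu_ext.
Qed.

(** For compact [K] the enlargement is closed, hence Borel, and the outer measure is the measure
    itself. *)
Lemma dP_lt (X : pmetricType R) (mu nu : {measure set (borel X) -> \bar R}) e :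
  dP mu nu < e%:E -> exists d, [/\ (0 < d)%R, (d <= e)%R &
    forall K : set X, compact K ->
      mu K <= nu (enlarge K d) + d%:E /\ nu K <= mu (enlarge K d) + d%:E].
Proof.
move=> /ereal_inf_lt[_ [d [d0 dA] <-]]; rewrite lte_fin => /ltW de.
exists d; split => // K cK.
have mK : measurable (enlarge K d : set (borel X)).
  by apply: closed_borel; exact: enlarge_closed.
by have := dA K (compact_borel cK); rewrite !measurable_mu_extE.
Qed.

End distances.

Section common_space.
Context {R : realType} (X_ : nat -> rbcmm R) (X : rbcmm R) (M : bcmType R)
  (f_ : forall n, isoEmb (X_ n) M) (f : isoEmb X M).
Hypothesis fell : isoEmb_range (f_ n) @[n --> \oo] --> isoEmb_range f.
Hypothesis root_cvg : f_ n (rootpt (X_ n)) @[n --> \oo] --> f (rootpt X).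
Hypothesis vague : vague_cvg (fun n => image_measure (f_ n) (meas (X_ n)))
  (image_measure f (meas X)).
Local Open Scope ereal_scope.

Let nu_ n := image_measure (f_ n) (meas (X_ n)).
Let nu := image_measure f (meas X).
Let p_ n := f_ n (rootpt (X_ n)).
Let p := f (rootpt X).

Let rnu : radon nu. Proof. exact/image_measure_radon/meas_radon. Qed.

Lemma common_space_d_local : (forall n, root_preserving (f_ n)) ->
  root_preserving f -> cvg_metric (@d_local R) X_ X.
Proof.
move=> f_root froot.
(* All truncations are centred at the root of [M], so [M] itself competes in the infimum defining
   [d_local]. *)
have pE : p = rootpt M by [].
have p_E n : p_ n = rootpt M by exact: f_root.
have [B cB HB] := fell_trunc fell root_cvg.
have dF0 : dF (isoEmb_range (f_ n)) (isoEmb_range f) @[n --> \oo] --> 0.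
  apply: (local_integral_cvg0 _ cB) => [n r|r _ Br]; first exact: dH_ge0.
  apply: ereal_cvg0 => [n|e e0]; first exact: dH_ge0.
  apply: filterS (HB r e Br e0) => n.
  rewrite -/(p_ n) -/p p_E pE => -[h1 h2].
  by apply: dH_le => //; exact: ltW.
have dV0 : dV (nu_ n) nu @[n --> \oo] --> 0.
  apply: (local_integral_cvg0 _ (countable_spheres p rnu)) => [n r|r _ Br].
    exact: dP_ge0.
  apply: ereal_cvg0 => [n|e e0]; first exact: dP_ge0.
  have {}Br : nu (sphere p r) = 0 by apply/eqP; apply: contrapT => /negP.
  apply: filterS (vague_trunc vague rnu root_cvg Br e0) => n H.
  apply: dP_le => // A mA; have [C [C' [[cC cC'] AC CA H1 H2]]] := H A.
  have mC := closed_borel cC; have mC' := closed_borel cC'.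
  have AD : A `&` cdisk (rootpt M) r `<=` C `&` cdisk (rootpt M) r.
    move=> x [Ax xr]; split => //; apply: AC; split => //.
    by rewrite -/p pE; apply: cdiskS xr; rewrite mdistxx; lra.
  have le (m : {measure set (borel M) -> \bar R}) :
      m (A `&` cdisk (rootpt M) r) <= m (C `&` cdisk (rootpt M) r).
    apply: le_measure; rewrite ?inE//; apply: measurableI => //; exact: cdisk_borel.
  rewrite -/(p_ n) -/p p_E pE in H1 H2.
  split; exists C'; split => //; rewrite /mrestr.
    exact: le_trans (le _) H1.
  exact: le_trans (le _) H2.
apply: ereal_cvg0 => [n|e e0].
  apply: le_ereal_inf_tmp => _ [Z [g [h [_ _ ->]]]].
  by rewrite le_max local_integral_ge0// => r; exact: dH_ge0.
apply: filterS2 (cvg0_lt dF0 e0) (cvg0_lt dV0 e0) => n h1 h2.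
apply: (@le_trans _ _ (maxe (dF (isoEmb_range (f_ n)) (isoEmb_range f))
  (dV (nu_ n) nu))); last by rewrite ge_max !ltW.
by apply: ereal_inf_lbound; exists M, (f_ n), f.
Qed.

End common_space.

Lemma enlarge_val {R : realType} (M : metricType R) (A : set M)
    (B C : set (set_type A)) (B' C' : set M) (e : R) :
  B `<=` [set k | B' (val k)] -> (forall x, C' x -> A x) ->
  (forall k, C' (val k) -> C k) ->
  B' `<=` enlarge C' e -> B `<=` enlarge C e.
Proof.
move=> BB CA CC BC k /BB /BC[y C'y ky].
have yA : y \in A by rewrite inE; exact: CA.
by exists (exist _ y yA) => //; exact: CC.
Qed.

Section ball_embedding.
Context {R : realType} (X M : bcmType R) (f : isoEmb X M) (r : {nonneg R})
  (q : M) (s : R).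
Hypothesis fr : mdist q (f (rootpt X)) + r%:num <= s.

Let fP (x : ball_space X r) : f (val x) \in cdisk q s.
Proof.
have xr := set_valP (x : set_type (cdisk (rootpt X) r%:num)).
by apply/mem_set/(cdiskS fr); rewrite /cdisk/= isoEmbP.
Qed.

Definition ball_emb_fun (x : ball_space X r) : set_type (cdisk q s) :=
  exist _ (f (val x)) (fP x).

Lemma ball_emb_isometry x y :
  mdist (ball_emb_fun x) (ball_emb_fun y) = mdist x y.
Proof. exact: (isoEmbP f). Qed.

Definition ball_emb : isoEmb (ball_space X r) (set_type (cdisk q s)) :=
  IsoEmb ball_emb_isometry.

Lemma range_ball_emb :
  range ball_emb = [set k | (range f `&` cdisk (f (rootpt X)) r%:num) (val k)].
Proof.
apply/seteqP; split => [_ [x _ <-]|k /= [[x _ xk] kr]].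
  have xr := set_valP (x : set_type (cdisk (rootpt X) r%:num)).
  by split; [exists (val x)|rewrite /cdisk/= isoEmbP].
have xr : x \in cdisk (rootpt X) r%:num.
  by rewrite inE; move: kr; rewrite -xk /cdisk/= isoEmbP.
by exists (exist _ x xr) => //; apply: val_inj.
Qed.

Lemma ball_emb_measure (mu : {measure set (borel X) -> \bar R}) (C : set M) :
  ball_measure mu (ball_emb @^-1` [set k | C (val k)]) =
  image_measure f mu (C `&` cdisk (f (rootpt X)) r%:num).
Proof.
congr (mu _); apply/seteqP; split => [_ [x Cx <-]|x /= [Cx xr]].
  have xr := set_valP (x : set_type (cdisk (rootpt X) r%:num)).
  by split => //; rewrite /cdisk/= isoEmbP.
have xr' : x \in cdisk (rootpt X) r%:num.
  by rewrite inE; move: xr; rewrite /cdisk/= isoEmbP.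
by exists (exist _ x xr').
Qed.

End ball_embedding.

Section common_space_pGHP.
Context {R : realType} (X_ : nat -> rbcmm R) (X : rbcmm R) (M : bcmType R)
  (f_ : forall n, isoEmb (X_ n) M) (f : isoEmb X M).
Hypothesis fell : isoEmb_range (f_ n) @[n --> \oo] --> isoEmb_range f.
Hypothesis root_cvg : f_ n (rootpt (X_ n)) @[n --> \oo] --> f (rootpt X).
Hypothesis vague : vague_cvg (fun n => image_measure (f_ n) (meas (X_ n)))
  (image_measure f (meas X)).
Local Open Scope ereal_scope.

Let nu_ n := image_measure (f_ n) (meas (X_ n)).
Let nu := image_measure f (meas X).
Let p_ n := f_ n (rootpt (X_ n)).
Let p := f (rootpt X).

Let rnu : radon nu. Proof. exact/image_measure_radon/meas_radon. Qed.

Lemma common_space_d_pGHP (r e : R) : (0 <= r)%R -> (0 < e)%R ->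
  nu (sphere p r) = 0 ->
  (\forall n \near \oo,
    range (f_ n) `&` cdisk (p_ n) r `<=` enlarge (range f `&` cdisk p r) e /\
    range f `&` cdisk p r `<=` enlarge (range (f_ n) `&` cdisk (p_ n) r) e) ->
  \forall n \near \oo,
    d_pGHP (trunc (X_ n) (`|r|%:nng)%R) (trunc X (`|r|%:nng)%R) <= e%:E.
Proof.
move=> r0 e0 sr HF.
have rE : ((`|r|%:nng)%R)%:num = r :> R by rewrite /= ger0_norm.
have near1 e1 : (0 < e1)%R -> \forall n \near \oo, (mdist p (p_ n) < e1)%R.
  by move=> e10; apply: metricType_numDomainType.cvgr_dist_lt.
(* Once [p_ n] is within 1 of [p], the compact ball of radius [r + 1] about [p] contains both
   truncated spaces and can serve as their common compact space. *)
pose s := (r + 1)%R.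
have ps : p \in cdisk p s.
  by rewrite inE /cdisk/= mdistxx /s; lra.
pose K : pmetricType R :=
  HB.pack (set_type (cdisk p s))
    (isPointed.Build (set_type (cdisk p s)) (exist (fun x => x \in cdisk p s) p ps)).
have cK : compact [set: K] by apply: set_type_compact; exact: cdisk_compact.
apply: filterS3 HF (filterI (near1 1%R ltr01) (near1 e e0))
  (vague_trunc vague rnu root_cvg sr e0) => n [F1 F2] [d1 de] V.
have h1 : (mdist p (f_ n (rootpt (X_ n))) + ((`|r|%:nng)%R)%:num <= s)%R.
  by rewrite rE -/(p_ n) /s; lra.
have h2 : (mdist p (f (rootpt X)) + ((`|r|%:nng)%R)%:num <= s)%R.
  by rewrite rE -/p mdistxx /s; lra.
pose g1 : isoEmb (trunc (X_ n) (`|r|%:nng)%R) K := ball_emb h1.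
pose g2 : isoEmb (trunc X (`|r|%:nng)%R) K := ball_emb h2.
apply: (@le_trans _ _ (maxe (maxe (dH (range g1) (range g2))
  (dP (image_measure g1 (cmeas (trunc (X_ n) (`|r|%:nng)%R)))
      (image_measure g2 (cmeas (trunc X (`|r|%:nng)%R)))))
  (mdist (g1 (rootpt (trunc (X_ n) (`|r|%:nng)%R)))
         (g2 (rootpt (trunc X (`|r|%:nng)%R))))%:E)).
  by apply: ereal_inf_lbound; exists K, g1, g2.
rewrite !ge_max; apply/andP; split; [apply/andP; split|]; last first.
- by rewrite lee_fin metric_sym ltW.
- have mval (C : set M) : closed C -> measurable ([set k : K | C (val k)] : set (borel K)).
    move=> cC; apply: closed_borel.
    by apply: (@preimage_closed _ _ (val : K -> M)) => // k _; exact: initial_continuous.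
  apply: dP_le => // A mA.
  (* [vague_trunc] applies to arbitrary sets, so the image of [A] in [M] need not be shown to be
     Borel. *)
  have [C [C' [[cC cC'] AC CA H1 H2]]] := V [set x | exists2 k : K, A k & val k = x].
  have AC' : A `<=` [set k | C (val k)].
    move=> k Ak; apply: AC; split; first by exists k.
    by have := set_valP (k : set_type (cdisk p s)).
  have CA' : [set k : K | C' (val k)] `<=` enlarge (A : set K) e.
    by move=> k /CA[_ [k' Ak' <-]] kk'; exists k'.
  have le (m : {measure set (borel K) -> \bar R}) : m A <= m [set k | C (val k)].
    by apply: le_measure; rewrite ?inE//; exact: mval.
  have E1 (D : set M) : image_measure g1 (cmeas (trunc (X_ n) (`|r|%:nng)%R))
      [set k | D (val k)] = nu_ n (D `&` cdisk (p_ n) r).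
    by rewrite /image_measure /pushforward/= [LHS](ball_emb_measure h1) /= ger0_norm.
  have E2 (D : set M) : image_measure g2 (cmeas (trunc X (`|r|%:nng)%R))
      [set k | D (val k)] = nu (D `&` cdisk p r).
    by rewrite /image_measure /pushforward/= [LHS](ball_emb_measure h2) /= ger0_norm.
  have {}H1 : nu_ n (C `&` cdisk (p_ n) r) <= nu (C' `&` cdisk p r) + e%:E := H1.
  have {}H2 : nu (C `&` cdisk p r) <= nu_ n (C' `&` cdisk (p_ n) r) + e%:E := H2.
  rewrite -E1 -E2 in H1; rewrite -E1 -E2 in H2.
  split; exists [set k | C' (val k)]; split => //; do ?exact: mval.
    exact: le_trans (le _) H1.
  exact: le_trans (le _) H2.
- have G1 : range g1 = [set k | (range (f_ n) `&` cdisk (p_ n) r) (val k)].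
    by rewrite [LHS](range_ball_emb h1) /= ger0_norm.
  have G2 : range g2 = [set k | (range f `&` cdisk p r) (val k)].
    by rewrite [LHS](range_ball_emb h2) /= ger0_norm.
  apply: dH_le; first exact: ltW.
    rewrite G1 G2; apply: (enlarge_val _ _ _ F1) => // x [_]; apply: cdiskS.
    by rewrite mdistxx /s; lra.
  rewrite G1 G2; apply: (enlarge_val _ _ _ F2) => // x [_]; apply: cdiskS.
  by rewrite /s; lra.
Qed.

Lemma common_space_d_GHV : cvg_metric (@d_GHV R) X_ X.
Proof.
have [B cB HB] := fell_trunc fell root_cvg.
have D0 (A A' : rcmm R) : 0 <= d_pGHP A A'.
  apply: le_ereal_inf_tmp => _ [K [g1 [g2 [_ ->]]]].
  by rewrite !le_max dH_ge0.
apply: (@local_integral_cvg0 _ _ (B `|` [set r | nu (sphere p r) != 0])).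
- by move=> n r; exact: D0.
- by rewrite -bigcup2E; apply: bigcup_countable => // -[|[|n]] _ //=;
    exact: countable_spheres.
move=> r r0 Br; apply: ereal_cvg0 => [n|e e0]; first exact: D0.
apply: common_space_d_pGHP => //.
  by apply/eqP; apply: contrapT => /negP ?; apply: Br; right.
by apply: HB => // rB; apply: Br; left.
Qed.

End common_space_pGHP.

(** * Couplings *)

Section coupling.
Context {R : realType}.

(** Partners [y] and sets [B] range over all of [Y] rather than over a ball. The condition is thus
    monotone in the radius, and no radius is exceptional. *)
Definition half_coupling (X Y : rbcmm R) (r e : R) (del : X -> Y -> R) : Prop :=
  (forall x, mdist (rootpt X) x <= r -> exists y, del x y <= e) /\
  (forall A : set X, closed A -> A `<=` cdisk (rootpt X) r ->
    exists B : set (borel Y), [/\ measurable B,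
      forall y : Y, B y -> exists2 x : X, A x & del x y <= e &
      (meas X A <= meas Y B + e%:E)%E]).

Definition coupling (X Y : rbcmm R) (r e : R) (del : X -> Y -> R) : Prop :=
  half_coupling r e del /\ half_coupling r e (fun y x => del x y).

Definition rooted_cross (X Y : rbcmm R) (del : X -> Y -> R) : Prop :=
  is_cross del /\ del (rootpt X) (rootpt Y) = 0.

Definition asymptotically_coupled (X_ : nat -> rbcmm R) (X : rbcmm R) : Prop :=
  forall r e, 0 < e -> \forall n \near \oo,
    exists del : X_ n -> X -> R, rooted_cross del /\ coupling r e del.

Lemma half_couplingW (X Y : rbcmm R) (r r' e e' : R) (del : X -> Y -> R) :
  r' <= r -> e <= e' -> half_coupling r e del -> half_coupling r' e' del.
Proof.
move=> rr ee [H1 H2]; split=> [x xr|A cA Ar].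
  by have [y xy] := H1 x (le_trans xr rr); exists y; exact: le_trans ee.
have [|B [mB BA AB]] := H2 A cA.
  by move=> x /Ar; rewrite /cdisk/= => /le_trans; apply.
exists B; split => // [y /BA[x Ax xy]|]; first by exists x => //; exact: le_trans ee.
by apply: (le_trans AB); rewrite leeD2l// lee_fin.
Qed.

(** The spaces are joined at their roots only. This provides a cross-distance at the indices where
    no good coupling is available. *)
Lemma wedge_cross (X Y : rbcmm R) : exists del : X -> Y -> R, rooted_cross del.
Proof.
pose W (x : X) (y : Y) (w : R) := [/\ x = rootpt X, y = rootpt Y & w = 0].
have W0 : exists x y w, W x y w by exists (rootpt X), (rootpt Y), 0.
have WX x1 y1 w1 x2 y2 w2 : W x1 y1 w1 -> W x2 y2 w2 ->
    mdist x1 x2 <= w1 + w2 + mdist y1 y2.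
  by move=> [-> -> ->] [-> -> ->]; rewrite !mdistxx !addr0.
have WY x1 y1 w1 x2 y2 w2 : W x1 y1 w1 -> W x2 y2 w2 ->
    mdist y1 y2 <= w1 + w2 + mdist x1 x2.
  by move=> [-> -> ->] [-> -> ->]; rewrite !mdistxx !addr0.
have cg := cross_glue W0 WX WY.
exists (glue_dist W); split => //; apply/eqP; rewrite eq_le (cross_ge0 cg) andbT.
by apply: (glue_le_weight WX).
Qed.

End coupling.

(** For each [n], [best] takes a witness for the largest attainable [k <= n]; by monotonicity it
    serves all attainable [k <= n] at once. *)
Lemma diagonal_choice (T : nat -> Type) (P : forall n, T n -> Prop)
    (C : forall n, nat -> T n -> Prop) :
  (forall n, exists t, P n t) ->
  (forall k, \forall n \near \oo, exists t, P n t /\ C n k t) ->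
  (forall n j k t, (j <= k)%N -> C n k t -> C n j t) ->
  exists t : forall n, T n, (forall n, P n (t n)) /\
    forall k, \forall n \near \oo, C n k (t n).
Proof.
move=> exP exC monoC.
have best n : exists t, P n t /\
    forall k, (k <= n)%N -> (exists t, P n t /\ C n k t) -> C n k t.
  suff H m : exists t, P n t /\
      forall k, (k <= m)%N -> (exists t, P n t /\ C n k t) -> C n k t by exact: H.
  elim: m => [|m [t [Pt Ct]]].
    have [[t [Pt Ct]]|nC] := pselect (exists t, P n t /\ C n 0 t).
      by exists t; split => // k; rewrite leqn0 => /eqP ->.
    have [t Pt] := exP n; exists t; split => // k.
    by rewrite leqn0 => /eqP -> /nC.
  have [[t' [Pt' Ct']]|nC] := pselect (exists t, P n t /\ C n m.+1 t).
    by exists t'; split => // k km _; exact: monoC km Ct'.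
  exists t; split => // k; rewrite leq_eqVlt => /predU1P[-> /nC//|km].
  exact: Ct.
exists (fun n => projT1 (cid (best n))); split => [n|k].
  by case: cid => t [].
apply: filterS2 (exC k) (nbhs_infty_ge k) => n Ck kn.
by case: cid => t [_ /=]; apply.
Qed.

(** * From couplings to a common space *)

Section coupled_to_common_space.
Context {R : realType} (X_ : nat -> rbcmm R) (X : rbcmm R).

Lemma coupled_common_space : asymptotically_coupled X_ X ->
  exists (M : bcmType R) (f_ : forall n, isoEmb (X_ n) M) (f : isoEmb X M),
    [/\ forall n, root_preserving (f_ n), root_preserving f,
        isoEmb_range (f_ n) @[n --> \oo] --> isoEmb_range f &
        vague_cvg (fun n => image_measure (f_ n) (meas (X_ n)))
                  (image_measure f (meas X))].
Proof.
move=> coupled.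
(* Level [k] means radius [k] and error [1 / (k + 1)]; one cross-distance per [n] must serve every
   level eventually. *)
have [||n j k t jk [c1 c2]|del [cdel Hk]] := @diagonal_choice
    (fun n => X_ n -> X -> R) (fun n => @rooted_cross R (X_ n) X)
    (fun n k => @coupling R (X_ n) X k%:R k.+1%:R^-1).
- by move=> n; exact: wedge_cross.
- by move=> k; exact: coupled.
- by split; [apply: half_couplingW c1|apply: half_couplingW c2];
    rewrite ?ler_nat// lef_pV2 ?posrE// ler_nat.
have {Hk} Hdel r e : 0 < e -> \forall n \near \oo, coupling r e (del n).
  move=> e0; have [k [rk ke]] := nat_large r e0.
  apply: filterS (Hk k) => n [c1 c2].
  by split; [apply: half_couplingW c1|apply: half_couplingW c2].
have [M [f [f_ [froot f_root fdel]]]] : exists (M : bcmType R) (f : isoEmb X M)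
    (f_ : forall n, isoEmb (X_ n) M),
    [/\ root_preserving f, forall n, root_preserving (f_ n) &
        forall n u x, mdist (f_ n u) (f x) = del n u x].
  apply: (@sequential_gluing R X X_ del).
  - by move=> n; have [] := cdel n.
  - by move=> n; have [] := cdel n.
  - move=> r e e0; apply: filterS (Hdel r e e0) => n [[H _] _]; exact: H.
have rad n x : mdist (rootpt M) (f_ n x) = mdist (rootpt (X_ n)) x.
  by rewrite -(f_root n) isoEmbP.
have rad' x : mdist (rootpt M) (f x) = mdist (rootpt X) x.
  by rewrite -froot isoEmbP.
exists M, f_, f; split => //.
- apply/fell_cvgP; split => [K cK Kf|U oU [_ [[x _ <-] Ux]]].
    have [e e0 eK] := compact_closed_separated cK (isoEmb_range_closed (f := f))
      (etrans (setIC _ _) Kf).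
    have [r Kr] := compact_bounded_cdisk (rootpt M) cK.
    have e20 : 0 < e / 2 by lra.
    apply: filterS (Hdel r _ e20) => n [[H _] _].
    rewrite /miss/= -subset0 => _ [[u _ <-] Ku].
    have [|x ux] := H u; first by rewrite -rad; exact: Kr Ku.
    have := eK _ _ Ku (ex_intro2 _ _ x I erefl : range f (f x)).
    by rewrite fdel; lra.
  have [e e0 eU] := nbhs_mdist_sub (open_nbhs_nbhs (conj oU Ux)).
  have e20 : 0 < e / 2 by lra.
  apply: filterS (Hdel (mdist (rootpt X) x) _ e20) => n [_ [H _]].
  have [u ux] := H x (lexx _); exists (f_ n u); split; first by exists u.
  by apply: eU; rewrite metric_sym fdel; lra.
- apply: (@close_vague_cvg _ _ _ _ (rootpt M)).
    exact/image_measure_radon/meas_radon.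
  move=> r e e0; apply: filterS (Hdel r e e0) => n [[_ H1] [_ H2]] A cA Ar.
  have cpA : compact A by exact: bcm_compact Ar.
  have mE : measurable (enlarge A e : set (borel M)).
    by apply: closed_borel; exact: enlarge_closed.
  split.
    have [||B [mB BA AB]] := H1 (f_ n @^-1` A).
    + by apply: preimage_closed => // x _; exact: isoEmb_continuous.
    + by move=> x /Ar; rewrite /cdisk/= rad.
    apply: (le_trans AB); rewrite leeD2r//.
    apply: le_measure; rewrite ?inE//.
      by rewrite -[X in measurable X]setTI; exact: isoEmb_measurable.
    move=> y /BA[x Ax xy]; exists (f_ n x) => //.
    by rewrite metric_sym fdel.
  have [||B [mB BA AB]] := H2 (f @^-1` A).
  + by apply: preimage_closed => // x _; exact: isoEmb_continuous.
  + by move=> x /Ar; rewrite /cdisk/= rad'.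
  apply: (le_trans AB); rewrite leeD2r//.
  apply: le_measure; rewrite ?inE//.
    by rewrite -[X in measurable X]setTI; exact: isoEmb_measurable.
  move=> y /BA[x Ax xy]; exists (f x) => //.
  by rewrite fdel.
Qed.

End coupled_to_common_space.

(** * From the metrics to couplings *)

Section coupling_from_distances.
Context {R : realType}.

(** The radii [s] and [s'] differ because the Hausdorff and Prohorov integrals become small at
    separately found radii; both only need to exceed [r]. *)
Lemma emb_half_coupling (X Y : rbcmm R) (Z : bcmType R) (f : isoEmb X Z)
    (g : isoEmb Y Z) (r e s s' d : R) :
  root_preserving f -> r <= s -> r <= s' -> d <= e ->
  range f `&` cdisk (rootpt Z) s `<=` enlarge (range g `&` cdisk (rootpt Z) s) e ->
  (forall K : set Z, compact K ->
    (image_measure f (meas X) (K `&` cdisk (rootpt Z) s') <=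
     image_measure g (meas Y) (enlarge K d `&` cdisk (rootpt Z) s') + d%:E)%E) ->
  half_coupling r e (fun x y => mdist (f x) (g y)).
Proof.
move=> froot rs rs' de fg mfg.
have rad x : mdist (rootpt Z) (f x) = mdist (rootpt X) x.
  by rewrite -froot isoEmbP.
split=> [x xr|A cA Ar].
  have [|y [[z _ <-] _] xy] := fg (f x); last by exists z.
  by split; [exists x|rewrite /cdisk/= rad (le_trans xr)].
have cfA : compact (f @` A).
  apply: continuous_compact; last exact: bcm_compact Ar.
  by apply: continuous_subspaceT; exact: isoEmb_continuous.
have mE : measurable (enlarge (f @` A) d `&` cdisk (rootpt Z) s' : set (borel Z)).
  apply: measurableI; last exact: cdisk_borel.
  by apply: closed_borel; exact: enlarge_closed.
exists (g @^-1` (enlarge (f @` A) d `&` cdisk (rootpt Z) s')); split.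
- by rewrite -[X in measurable X]setTI; exact: isoEmb_measurable.
- move=> y [[_ [x Ax <-] xy] _]; exists x => //.
  by rewrite metric_sym (le_trans xy).
have AE : (f : borel X -> borel Z) @^-1` (f @` A `&` cdisk (rootpt Z) s') = A.
  apply/seteqP; split => [x [[u Au ux] _]|x Ax].
    suff -> : x = u by [].
    by apply: mdist_positivity; rewrite -(isoEmbP f) ux mdistxx.
  by split; [exists x|rewrite /cdisk/= rad (le_trans (Ar x Ax))].
have := mfg _ cfA; rewrite {1}/image_measure /pushforward AE => /le_trans; apply.
by rewrite leeD2l// lee_fin.
Qed.

(** The good radius is sought in [[r, r + 1]], whose length 1 drops out of the bound. *)
Lemma local_integral_radius (D : R -> \bar R) (r c : R) :
  (forall s, 0 <= D s)%E -> 0 <= r -> 0 < c <= 1 ->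
  (local_integral D < (c * expR (- (r + 1)))%:E)%E ->
  exists2 s, r <= s & (D s <= c%:E)%E.
Proof.
move=> D0 r0 c01 Dc.
have [||s /andP[rs _] sc] := @local_integral_small _ D r (r + 1) c D0 _ c01.
- by rewrite r0 ltrDl ltr01.
- by rewrite [r + 1 - r]addrAC subrr add0r mulr1.
by exists s.
Qed.

Lemma d_local_coupled (X_ : nat -> rbcmm R) (X : rbcmm R) :
  cvg_metric (@d_local R) X_ X -> asymptotically_coupled X_ X.
Proof.
move=> dX r e e0.
(* The given [r] may be negative, whereas the integral sees only non-negative radii. [c] is at most
   1 because the integrand is truncated there, and below [e] to get strict inequalities. *)
pose r' := Num.max r 0; pose c := Num.min (e / 2) 1.
have r'0 : 0 <= r' by rewrite le_max lexx orbT.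
have rr' : r <= r' by rewrite le_max lexx.
have c0 : 0 < c by rewrite lt_min; lra.
have c01 : 0 < c <= 1 by rewrite c0 ge_min lexx orbT.
have ce : c < e.
  have : c <= e / 2 by rewrite ge_min lexx.
  lra.
have t0 : 0 < c * expR (- (r' + 1)) by rewrite mulr_gt0// expR_gt0.
apply: filterS (cvg0_lt dX t0) => n /ereal_inf_lt[_ [Z [f [g [froot groot ->]]]]].
rewrite gt_max => /andP[/local_integral_radius dF_small /local_integral_radius dV_small].
have [|s rs /le_lt_trans] := dF_small _ r'0 c01; first by move=> s; exact: dH_ge0.
move=> /(_ e%:E); rewrite lte_fin => /(_ ce) /dH_lt[fg gf].
have [|s' rs' /le_lt_trans] := dV_small _ r'0 c01; first by move=> s'; exact: dP_ge0.
move=> /(_ e%:E); rewrite lte_fin => /(_ ce) /dP_lt[d [d0 de fgd]].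
exists (fun x y => mdist (f x) (g y)); split; [split|split].
- exact: cross_emb.
- by rewrite froot groot mdistxx.
- apply: (emb_half_coupling froot (le_trans rr' rs) (le_trans rr' rs') de) => //.
  by move=> K cK; have [] := fgd K cK.
- rewrite (_ : (fun y x => _) = (fun y x => mdist (g y) (f x))); last first.
    by apply/funext => y; apply/funext => x; rewrite metric_sym.
  apply: (emb_half_coupling groot (le_trans rr' rs) (le_trans rr' rs') de) => //.
  by move=> K cK; have [] := fgd K cK.
Qed.

Section reroot.
Context (X Y : rbcmm R) (s : {nonneg R}) (K : pmetricType R)
  (f : isoEmb (ball_space X s) K) (g : isoEmb (ball_space Y s) K).

Let x0 : ball_space X s := rootpt (ball_space X s).
Let y0 : ball_space Y s := rootpt (ball_space Y s).
Let c0 := mdist (f x0) (g y0).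

(* Raising the distances of [K] by [c0] makes room for the pair of roots to be
   at distance [0]. *)
Definition reroot_weight (x : X) (y : Y) (w : R) : Prop :=
  exists (x' : ball_space X s) (y' : ball_space Y s), [/\ x = val x', y = val y' &
    [/\ x' = x0, y' = y0 & w = 0] \/ w = mdist (f x') (g y') + c0].

Let W := reroot_weight.

Lemma reroot_root : W (rootpt X) (rootpt Y) 0.
Proof. by exists x0, y0; split => //; left. Qed.

Lemma reroot_pair (x' : ball_space X s) (y' : ball_space Y s) :
  W (val x') (val y') (mdist (f x') (g y') + c0).
Proof. by exists x', y'; split => //; right. Qed.

(** The only delicate case pairs the roots with another pair: the roots contribute weight 0 instead
    of [c0], and the raise of the other weight pays for exactly that. *)
Lemma reroot_compatX x1 y1 w1 x2 y2 w2 : W x1 y1 w1 -> W x2 y2 w2 ->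
  mdist x1 x2 <= w1 + w2 + mdist y1 y2.
Proof.
move=> [x1' [y1' [-> -> H1]]] [x2' [y2' [-> -> H2]]].
change (mdist x1' x2' <= w1 + w2 + mdist y1' y2').
have : mdist x1' x2' <= mdist (f x1') (g y1') + mdist y1' y2' + mdist (f x2') (g y2').
  rewrite -(isoEmbP f) -(isoEmbP g).
  have := metric_triangle (f x1') (g y1') (f x2').
  by have := metric_triangle (g y1') (g y2') (f x2'); rewrite [mdist (g y2') _]metric_sym; lra.
have c00 : 0 <= c0 by exact: mdist_ge0.
case: H1 => [[-> -> ->]|->]; case: H2 => [[-> -> ->]|->]; rewrite -?/c0.
- by rewrite !mdistxx; lra.
- by lra.
- by lra.
- by lra.
Qed.

End reroot.

Lemma reroot_compatY (X Y : rbcmm R) (s : {nonneg R}) (K : pmetricType R)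
    (f : isoEmb (ball_space X s) K) (g : isoEmb (ball_space Y s) K) x1 y1 w1 x2 y2 w2 :
  reroot_weight f g x1 y1 w1 -> reroot_weight f g x2 y2 w2 ->
  mdist y1 y2 <= w1 + w2 + mdist x1 x2.
Proof.
suff swap x y w : reroot_weight f g x y w -> reroot_weight g f y x w.
  by move=> /swap W1 /swap W2; exact: reroot_compatX W1 W2.
move=> [x' [y' [xx yy H]]]; exists y', x'; split => //.
case: H => [[-> -> ->]|->]; [by left|right].
by congr (_ + _); exact: metric_sym.
Qed.

(** [e] is the precision in [K] and [c] the raise of the cross-distances; their sum must fit within
    [d]. *)
Lemma pGHP_half_coupling (X Y : rbcmm R) (s : {nonneg R}) (K : pmetricType R)
    (f : isoEmb (ball_space X s) K) (g : isoEmb (ball_space Y s) K)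
    (del : X -> Y -> R) (r e c d : R) :
  r <= s%:num -> c + e <= d ->
  (forall x' y', del (val x') (val y') <= mdist (f x') (g y') + c) ->
  range f `<=` enlarge (range g) e ->
  (forall A : set K, compact A -> (image_measure f (ball_measure (meas X)) A <=
    image_measure g (ball_measure (meas Y)) (enlarge A e) + d%:E)%E) ->
  half_coupling r d del.
Proof.
move=> rs cde delK fg mfg.
have inb (x : X) : mdist (rootpt X) x <= r -> x \in cdisk (rootpt X) s%:num.
  by move=> xr; rewrite inE /cdisk/= (le_trans xr).
split=> [x xr|A cA Ar].
  have [y' [z _ zy] xy] := fg _ (ex_intro2 _ _ (exist _ x (inb x xr) : ball_space X s) I erefl).
  exists (val z); apply: le_trans (delK (exist _ x (inb x xr)) z) _.
  by rewrite zy; lra.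
pose A' : set (ball_space X s) := [set x' | A (val x')].
have cA' : compact A'.
  apply: (@subclosed_compact _ _ [set: ball_space X s]) => //.
    apply: (@preimage_closed _ _ (val : ball_space X s -> X)) => // k _.
    exact: initial_continuous.
  exact: ball_space_compact.
have cfA : compact (f @` A').
  apply: continuous_compact => //.
  by apply: continuous_subspaceT; exact: isoEmb_continuous.
have mE : measurable (enlarge (f @` A') e : set (borel K)).
  by apply: closed_borel; exact: enlarge_closed.
exists (val @` (g @^-1` enlarge (f @` A') e)); split.
- apply: ball_space_image_borel.
  by rewrite -[X in measurable X]setTI; exact: isoEmb_measurable.
- move=> _ [y' [_ [x' Ax <-] xy] <-]; exists (val x') => //.
  by apply: le_trans (delK x' y') _; rewrite metric_sym; lra.
have AE : val @` ((f : borel (ball_space X s) -> borel K) @^-1` (f @` A')) = A.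
  apply/seteqP; split => [_ [x' [u Au ux] <-]|x Ax].
    suff -> : x' = u by [].
    by apply: mdist_positivity; rewrite -(isoEmbP f) ux mdistxx.
  have xs := inb x (Ar x Ax).
  by exists (exist _ x xs) => //; exists (exist _ x xs).
have H : (meas X (val @` ((f : borel (ball_space X s) -> borel K) @^-1` (f @` A'))) <=
    image_measure g (ball_measure (meas Y)) (enlarge (f @` A') e) + d%:E)%E := mfg _ cfA.
by rewrite AE in H.
Qed.

Lemma d_GHV_coupled (X_ : nat -> rbcmm R) (X : rbcmm R) :
  cvg_metric (@d_GHV R) X_ X -> asymptotically_coupled X_ X.
Proof.
move=> dX r e e0.
(* Being below [e / 2], [c] leaves one half of [e] for the closeness in [K] and the other for the
   distance of the roots, by which the cross-distances are raised. *)
pose r' := Num.max r 0; pose c := Num.min (e / 3) 1.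
have r'0 : 0 <= r' by rewrite le_max lexx orbT.
have rr' : r <= r' by rewrite le_max lexx.
have c0 : 0 < c by rewrite lt_min; lra.
have c01 : 0 < c <= 1 by rewrite c0 ge_min lexx orbT.
have ce : c < e / 2.
  have : c <= e / 3 by rewrite ge_min lexx.
  lra.
have t0 : 0 < c * expR (- (r' + 1)) by rewrite mulr_gt0// expR_gt0.
apply: filterS (cvg0_lt dX t0) => n /local_integral_radius small.
have [|s rs] := small _ r'0 c01.
  move=> s; apply: le_ereal_inf_tmp => _ [K [g1 [g2 [_ ->]]]].
  by rewrite !le_max dH_ge0.
set s' := (`|s|%:nng : {nonneg R}).
have rs' : r <= s'%:num by rewrite /= (le_trans rr')// (le_trans rs)// ler_norm.
move=> /le_lt_trans /(_ (_ : (c%:E < (e / 2)%:E)%E)); rewrite lte_fin => /(_ ce).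
move=> /ereal_inf_lt[_ [K [f [g [cK ->]]]]].
rewrite !gt_max => /andP[/andP[/dH_lt[fg gf] /dP_lt[d [d0 de fgd]]]].
rewrite lte_fin => roots.
pose W := reroot_weight f g.
have W0 : exists x y w, W x y w.
  by exists (rootpt (X_ n)), (rootpt X), 0; exact: reroot_root.
have WX := @reroot_compatX (X_ n) X s' K f g.
have WY := @reroot_compatY (X_ n) X s' K f g.
have cg := cross_glue W0 WX WY.
have gle := glue_le_weight WX.
pose c1 := mdist (f (rootpt _)) (g (rootpt _)).
have fgd' (A : set K) : compact A ->
    (image_measure f (ball_measure (meas (X_ n))) A <=
       image_measure g (ball_measure (meas X)) (enlarge A (e / 2)) + e%:E)%E /\
    (image_measure g (ball_measure (meas X)) A <=
       image_measure f (ball_measure (meas (X_ n))) (enlarge A (e / 2)) + e%:E)%E.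
  move=> cA; have [H1 H2] := fgd A cA.
  have le (m : {measure set (borel K) -> \bar R}) :
      (m (enlarge A d) + d%:E <= m (enlarge A (e / 2)) + e%:E)%E.
    apply: leeD; last by rewrite lee_fin; lra.
    apply: le_measure; rewrite ?inE; last exact: enlargeS.
    - by apply: closed_borel; exact: enlarge_closed.
    - by apply: closed_borel; exact: enlarge_closed.
  by split; [exact: le_trans H1 (le _)|exact: le_trans H2 (le _)].
exists (glue_dist W); split; [split => //|split].
- apply/eqP; rewrite eq_le (cross_ge0 cg) andbT.
  by apply: gle; exact: reroot_root.
- apply: (@pGHP_half_coupling (X_ n) X s' K f g _ r (e / 2) c1) => //.
  + by rewrite /c1; lra.
  + by move=> x' y'; apply: gle; exact: reroot_pair.
  + by move=> A cA; have [H _] := fgd' A cA.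
- apply: (@pGHP_half_coupling X (X_ n) s' K g f _ r (e / 2) c1) => //.
  + by rewrite /c1; lra.
  + by move=> y' x'; rewrite [mdist (g y') _]metric_sym; apply: gle; exact: reroot_pair.
  + by move=> A cA; have [_ H] := fgd' A cA.
Qed.

End coupling_from_distances.

Theorem proposition8p10 (R : realType) (X_ : nat -> rbcmm R) (X : rbcmm R) :
  [<-> (* (i) *)
       cvg_metric (@d_local R) X_ X;
       (* (ii) *)
       exists (M : bcmType R) (f_ : forall n, isoEmb (X_ n) M) (f : isoEmb X M),
         [/\ forall n, root_preserving (f_ n), root_preserving f,
             isoEmb_range (f_ n) @[n --> \oo] --> isoEmb_range f &
             vague_cvg (fun n => image_measure (f_ n) (meas (X_ n)))
                       (image_measure f (meas X))];
       (* (iii) *)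
       exists (M : bcmType R) (f_ : forall n, isoEmb (X_ n) M) (f : isoEmb X M),
         [/\ isoEmb_range (f_ n) @[n --> \oo] --> isoEmb_range f,
             f_ n (rootpt (X_ n)) @[n --> \oo] --> f (rootpt X) &
             vague_cvg (fun n => image_measure (f_ n) (meas (X_ n)))
                       (image_measure f (meas X))];
       (* (iv) *)
       cvg_metric (@d_GHV R) X_ X].
Proof.
tfae.
- by move=> /d_local_coupled /coupled_common_space.
- move=> [M [f_ [f [f_root froot fell vague]]]]; exists M, f_, f; split => //.
  rewrite froot (_ : (fun n => _) = cst (rootpt M)); first exact: cvg_cst.
  by apply/funext => n; rewrite f_root.
- by move=> [M [f_ [f [fell roots vague]]]]; exact: common_space_d_GHV vague.
(* The cycle is closed through a common rooted space as in (ii), since the spaces realising [d_GHV]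
   vary with the radius. *)
- move=> /d_GHV_coupled /coupled_common_space [M [f_ [f [f_root froot fell vague]]]].
  apply: (common_space_d_local fell _ vague) => //.
  rewrite froot (_ : (fun n => _) = cst (rootpt M)); first exact: cvg_cst.
  by apply/funext => n; rewrite f_root.
Qed.
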